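(* Let $A$ be a Banach $*$-algebra, let $\alpha\ge2$ and put $\beta:=\alpha+1$. The following statements are equivalent: (i) $A$ is Hermitian; (ii) for each $a\in A$ one has $\mathrm{sp}(a^*a)\subset[-\lambda,\lambda]$, where $\lambda:=\max\big((\mathrm{sp}(a^*a)\cap[0,\infty))\cup\{0\}\big)$; (iii) for all $a\in A$ with $r_\sigma(a)\le1$ one has $r_\sigma(c)\le1$, where $c:=\alpha^{-1}(\beta a-aa^*a)$; (iv) for every $a\in A$, $\mathrm{sp}(a^*a)$ contains no real number $\lambda<0$; (v) $e+a^*a$ is invertible in $\widetilde A$ for all $a\in A$.
   Context: All algebras are complex. A normed $*$-algebra is a complex algebra $A$ with an involution $a\mapsto a^*$ (conjugate linear, $(ab)^*=b^*a^*$, $a^{**}=a$) and a norm $|\cdot|$ with $|ab|\le|a|\,|b|$; the involution is not assumed to be continuous. A Banach $*$-algebra is a complete normed $*$-algebra. $\widetilde A$ denotes $A$ if $A$ has a unit $e$, and otherwise the unitisation $\mathbb{C}e\oplus A$ with adjoined unit $e$ (with $(\lambda e+a)^*=\bar\lambda e+a^*$, $|\lambda e+a|=|\lambda|+|a|$). For $a\in A$, $\mathrm{sp}(a)=\{\lambda\in\mathbb{C}:\lambda e-a\text{ is not invertible in }\widetilde A\}$. For $a\in A$, $r_\lambda(a):=\inf_{n\ge1}|a^n|^{1/n}$ and $r_\sigma(a):=r_\lambda(a^*a)^{1/2}$. A $*$-algebra is Hermitian if every Hermitian element ($a=a^*$) has real spectrum. *)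

(* Defs.v *)
From Stdlib Require Import Reals ClassicalEpsilon.
Open Scope R_scope.

Record Cx : Type := mkC { Re : R ; Im : R }.
Definition Cadd (z w : Cx) : Cx := mkC (Re z + Re w) (Im z + Im w).
Definition Cmul (z w : Cx) : Cx :=
  mkC (Re z * Re w - Im z * Im w) (Re z * Im w + Im z * Re w).
Definition Cconj (z : Cx) : Cx := mkC (Re z) (- Im z).
Definition Cmod (z : Cx) : R := sqrt (Re z * Re z + Im z * Im z).
Definition RtoC (r : R) : Cx := mkC r 0.
Definition Czero : Cx := RtoC 0.
Definition Cone : Cx := RtoC 1.

(* ---------- Banach *-algebras (involution not assumed continuous) ---------- *)
Record BanachStarAlgebra : Type := {
  car :> Type;
  zero : car;
  add : car -> car -> car;
  opp : car -> car;
  scal : Cx -> car -> car;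
  mul : car -> car -> car;
  star : car -> car;
  norm : car -> R;
  add_assoc : forall a b c, add a (add b c) = add (add a b) c;
  add_comm : forall a b, add a b = add b a;
  add_zero : forall a, add a zero = a;
  add_opp : forall a, add a (opp a) = zero;
  scal_addl : forall l m a, scal (Cadd l m) a = add (scal l a) (scal m a);
  scal_addr : forall l a b, scal l (add a b) = add (scal l a) (scal l b);
  scal_mul : forall l m a, scal (Cmul l m) a = scal l (scal m a);
  scal_one : forall a, scal Cone a = a;
  mul_assoc : forall a b c, mul a (mul b c) = mul (mul a b) c;
  mul_addl : forall a b c, mul (add a b) c = add (mul a c) (mul b c);
  mul_addr : forall a b c, mul a (add b c) = add (mul a b) (mul a c);
  scal_mull : forall l a b, scal l (mul a b) = mul (scal l a) b;
  scal_mulr : forall l a b, scal l (mul a b) = mul a (scal l b);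
  star_add : forall a b, star (add a b) = add (star a) (star b);
  star_scal : forall l a, star (scal l a) = scal (Cconj l) (star a);
  star_mul : forall a b, star (mul a b) = mul (star b) (star a);
  star_star : forall a, star (star a) = a;
  norm_nonneg : forall a, 0 <= norm a;
  norm_eq0 : forall a, norm a = 0 -> a = zero;
  norm_triangle : forall a b, norm (add a b) <= norm a + norm b;
  norm_scal : forall l a, norm (scal l a) = Cmod l * norm a;
  norm_mul : forall a b, norm (mul a b) <= norm a * norm b;
  complete : forall u : nat -> car,
    (forall eps, eps > 0 -> exists N, forall m n, (m >= N)%nat -> (n >= N)%nat ->
        norm (add (u m) (opp (u n))) < eps) ->
    exists l, forall eps, eps > 0 -> exists N, forall n, (n >= N)%nat ->
        norm (add (u n) (opp l)) < eps
}.

Section Spectral.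
Variable A : BanachStarAlgebra.

Definition sub (a b : A) : A := add A a (opp A b).

Definition is_unit (u : A) : Prop := forall x : A, mul A u x = x /\ mul A x u = x.
Definition has_unit : Prop := exists u : A, is_unit u.

Definition inv_in_A (u x : A) : Prop :=
  exists y : A, mul A x y = u /\ mul A y x = u.

(* the unitisation C e (+) A: (l, x) stands for l e + x *)
Definition umul (p q : Cx * A) : Cx * A :=
  (Cmul (fst p) (fst q),
   add A (add A (scal A (fst p) (snd q)) (scal A (fst q) (snd p))) (mul A (snd p) (snd q))).
Definition inv_unitisation (p : Cx * A) : Prop :=
  exists q, umul p q = (Cone, zero A) /\ umul q p = (Cone, zero A).

(* invertibility of  l e + x  in A~  (A~ = A if A has a unit e, else the unitisation) *)
Definition inv_At (l : Cx) (x : A) : Prop :=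
  (has_unit /\ exists u, is_unit u /\ inv_in_A u (add A (scal A l u) x))
  \/ (~ has_unit /\ inv_unitisation (l, x)).

Definition sp (a : A) (z : Cx) : Prop := ~ inv_At z (opp A a).

Definition hermitian : Prop :=
  forall a : A, star A a = a -> forall z, sp a z -> Im z = 0.

(* pw a k = a^(k+1) *)
Fixpoint pw (a : A) (k : nat) : A :=
  match k with O => a | S k' => mul A a (pw a k') end.

Definition nroot (x : R) (n : nat) : R :=
  if Rle_dec x 0 then 0 else Rpower x (/ INR n).

Definition is_inf (E : R -> Prop) (m : R) : Prop :=
  (forall x, E x -> m <= x) /\ (forall b, (forall x, E x -> b <= x) -> b <= m).

Definition r_lambda (a : A) : R :=
  epsilon (inhabits 0) (is_inf (fun x => exists k : nat, x = nroot (norm A (pw a k)) (S k))).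

Definition r_sigma (a : A) : R := sqrt (r_lambda (mul A (star A a) a)).

Definition max_nonneg_sp (b : A) : R :=
  epsilon (inhabits 0) (is_lub (fun t => (0 <= t /\ sp b (RtoC t)) \/ t = 0)).

End Spectral.

(* Main.v *)
(** (i) => (ii) is the analytic part.  In a Hermitian algebra, r(a^* a) < 1 implies that e - a is
    invertible: with Ford's self-adjoint square root w of e - a^* a one has
    (e + a^* )(e - a) = w (e + w^-1 (a^* - a) w^-1) w, and e plus a skew element is invertible.
    Hence (Ptak) r(x y) < 1 follows from r(x^2 y^2) < 1 for self-adjoint x, y, so that products of
    self-adjoint elements of spectral radius < 1 have spectral radius < 1, and the factorisation
    e + h + k = (e + h)(e - h (e + h)^-1 k (e + k)^-1)(e + k) shows that sums of positive elements
    are positive.  If sp(a^* a) is bounded above by r, then a a^* = 2 (h^2 + k^2) - a^* a >= - r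
    for a = h + i k, which is (ii).

    For c as in (iii), c^* c = q(a^* a) with q(x) = x (beta - x)^2 / alpha^2.  This q maps [0,1]
    into [0,1] and is at most 0 on the negative axis, which gives (iii) from (ii); it expands
    negative numbers by a factor at least (beta / alpha)^2, so under (iii) a negative point of a
    spectrum would escape to infinity, which gives (iv).  If z is a non-real point of sp(h), h
    self-adjoint, a real polynomial p with p(0) = 0 and p(z) = i puts -1 into sp(p(h)^2), so (iv)
    implies (i).

    The non-unital case is reduced to the unitisation B of A along the embedding j : A -> B. *)

Require Import Defs.
From Stdlib Require Import Reals Lra Lia List ClassicalEpsilon Classical.
Import ListNotations.
Open Scope R_scope.

(** * Complex arithmetic *)

Lemma Cx_ext (z w : Cx) : Re z = Re w -> Im z = Im w -> z = w.
Proof. destruct z, w; simpl; intros -> ->; reflexivity. Qed.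

Definition Copp (z : Cx) : Cx := mkC (- Re z) (- Im z).
Definition Ci : Cx := mkC 0 1.

Ltac cx := apply Cx_ext; cbn [Re Im Cadd Cmul Cconj Copp Ci RtoC Czero Cone].

Definition Cinv (z : Cx) : Cx :=
  let d := Re z * Re z + Im z * Im z in mkC (Re z / d) (- Im z / d).

Lemma Cx_neq0_sq (z : Cx) : z <> Czero -> 0 < Re z * Re z + Im z * Im z.
Proof.
  intros H. destruct (Req_dec (Re z) 0) as [E|E]; [|nra].
  destruct (Req_dec (Im z) 0) as [F|F]; [|nra].
  exfalso; apply H; cx; assumption.
Qed.

Lemma Cmul_Cinv (z : Cx) : z <> Czero -> Cmul z (Cinv z) = Cone.
Proof. intros H%Cx_neq0_sq. unfold Cinv; cx; field; lra. Qed.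

Lemma Cmod_nonneg (z : Cx) : 0 <= Cmod z.
Proof. apply sqrt_pos. Qed.

Lemma Cmod_sq (z : Cx) : Cmod z * Cmod z = Re z * Re z + Im z * Im z.
Proof. apply sqrt_sqrt; nra. Qed.

Lemma Cmod_mul (z w : Cx) : Cmod (Cmul z w) = Cmod z * Cmod w.
Proof.
  unfold Cmod. rewrite <- sqrt_mult by nra. f_equal; simpl; ring.
Qed.

Lemma Cmod_RtoC (r : R) : Cmod (RtoC r) = Rabs r.
Proof.
  unfold Cmod; simpl. replace (r * r + 0 * 0) with (Rsqr r) by (unfold Rsqr; ring).
  apply sqrt_Rsqr_abs.
Qed.

Lemma Cmod_Copp (z : Cx) : Cmod (Copp z) = Cmod z.
Proof. unfold Cmod; f_equal; simpl; ring. Qed.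

Lemma Cmod_Cconj (z : Cx) : Cmod (Cconj z) = Cmod z.
Proof. unfold Cmod; f_equal; simpl; ring. Qed.

Lemma Cmod_Cone : Cmod Cone = 1.
Proof. unfold Cone; rewrite Cmod_RtoC; apply Rabs_R1. Qed.

Lemma Cmod_Czero : Cmod Czero = 0.
Proof. unfold Czero; rewrite Cmod_RtoC; apply Rabs_R0. Qed.

Lemma Cmod_eq0 (z : Cx) : Cmod z = 0 -> z = Czero.
Proof. intros H. pose proof (Cmod_sq z) as E. rewrite H in E. cx; nra. Qed.

Lemma Re_le_Cmod (z : Cx) : Rabs (Re z) <= Cmod z.
Proof.
  unfold Cmod. rewrite <- sqrt_Rsqr_abs. apply sqrt_le_1_alt. unfold Rsqr; nra.
Qed.

Lemma Im_le_Cmod (z : Cx) : Rabs (Im z) <= Cmod z.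
Proof.
  unfold Cmod. rewrite <- sqrt_Rsqr_abs. apply sqrt_le_1_alt. unfold Rsqr; nra.
Qed.

Lemma Cmod_add (z w : Cx) : Cmod (Cadd z w) <= Cmod z + Cmod w.
Proof.
  pose proof (Cmod_sq z); pose proof (Cmod_sq w); pose proof (Cmod_sq (Cadd z w)) as E.
  pose proof (Cmod_nonneg z); pose proof (Cmod_nonneg w); pose proof (Cmod_nonneg (Cadd z w)).
  assert (Re z * Re w + Im z * Im w <= Cmod z * Cmod w).
  { apply Rsqr_incr_0_var; [|nra]. unfold Rsqr.
    replace (Cmod z * Cmod w * (Cmod z * Cmod w))
      with ((Cmod z * Cmod z) * (Cmod w * Cmod w)) by ring.
    rewrite H, H0. pose proof (Rle_0_sqr (Re z * Im w - Im z * Re w)) as S; unfold Rsqr in S. nra. }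
  simpl in E. apply Rsqr_incr_0_var; unfold Rsqr; nra.
Qed.

Lemma Cmod_le_add (z : Cx) : Cmod z <= Rabs (Re z) + Rabs (Im z).
Proof.
  pose proof (Rabs_pos (Re z)); pose proof (Rabs_pos (Im z)).
  apply Rsqr_incr_0_var; [|lra]. unfold Rsqr. rewrite Cmod_sq.
  pose proof (Rsqr_abs (Re z)); pose proof (Rsqr_abs (Im z)). unfold Rsqr in *. nra.
Qed.

Lemma Cmod_Cinv (z : Cx) : z <> Czero -> Cmod (Cinv z) = / Cmod z.
Proof.
  intros H. pose proof (f_equal Cmod (Cmul_Cinv z H)) as E.
  rewrite Cmod_mul, Cmod_Cone in E.
  assert (Cmod z <> 0) by (intros F; rewrite F in E; lra).
  field_simplify_eq; [lra|assumption].
Qed.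

(** Half-angle formulas: the parts of the root have squares [(Cmod w + Re w) / 2] and
    [(Cmod w - Re w) / 2]; the sign of the imaginary part is matched to that of [Im w]. *)
Lemma Csqrt_ex (w : Cx) : exists z, Cmul z z = w.
Proof.
  pose proof (Cmod_sq w) as S; pose proof (Re_le_Cmod w) as L.
  assert (- Cmod w <= Re w <= Cmod w) by (unfold Rabs in L; destruct (Rcase_abs (Re w)); lra).
  set (p := sqrt ((Cmod w + Re w) / 2)). set (q := sqrt ((Cmod w - Re w) / 2)).
  assert (Hp : p * p = (Cmod w + Re w) / 2) by (apply sqrt_sqrt; lra).
  assert (Hq : q * q = (Cmod w - Re w) / 2) by (apply sqrt_sqrt; lra).
  assert (0 <= p) by apply sqrt_pos. assert (0 <= q) by apply sqrt_pos.
  assert (Hpq : 2 * (p * q) = Rabs (Im w)).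
  { apply Rsqr_inj; [nra|apply Rabs_pos|]. rewrite <- Rsqr_abs. unfold Rsqr.
    replace (2 * (p * q) * (2 * (p * q))) with (4 * (p * p) * (q * q)) by ring.
    rewrite Hp, Hq. nra. }
  unfold Rabs in Hpq; destruct (Rcase_abs (Im w)).
  - exists (mkC p (- q)); cx; nra.
  - exists (mkC p q); cx; nra.
Qed.

(** * Elementary consequences of the algebra axioms *)

Section Module.
Variable A : BanachStarAlgebra.

Lemma add_cancel (x y z : A) : add A x y = add A x z -> y = z.
Proof.
  intros H. apply (f_equal (fun t => add A t (opp A x))) in H.
  rewrite (add_comm A x y), (add_comm A x z), <- !add_assoc, !add_opp, !add_zero in H. exact H.
Qed.

Lemma scal_Czero (x : A) : scal A Czero x = zero A.
Proof.
  apply (add_cancel (scal A Czero x)). rewrite <- scal_addl, add_zero. f_equal. cx; ring.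
Qed.

Lemma scal_zero (c : Cx) : scal A c (zero A) = zero A.
Proof.
  rewrite <- (scal_Czero (zero A)), <- scal_mul. f_equal; cx; ring.
Qed.

Lemma opp_scal (x : A) : opp A x = scal A (Copp Cone) x.
Proof.
  apply (add_cancel x). rewrite add_opp. rewrite <- (scal_one A x) at 1.
  rewrite <- scal_addl, <- (scal_Czero x). f_equal; cx; ring.
Qed.

Lemma mul_zero_l (x : A) : mul A (zero A) x = zero A.
Proof. rewrite <- (scal_Czero (zero A)) at 1. rewrite <- scal_mull. apply scal_Czero. Qed.

Lemma mul_zero_r (x : A) : mul A x (zero A) = zero A.
Proof. rewrite <- (scal_Czero (zero A)) at 1. rewrite <- scal_mulr. apply scal_Czero. Qed.

Lemma star_opp (x : A) : star A (opp A x) = opp A (star A x).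
Proof. rewrite !opp_scal, star_scal. f_equal; cx; ring. Qed.

Lemma star_sub (x y : A) : star A (sub A x y) = sub A (star A x) (star A y).
Proof. unfold sub. now rewrite star_add, star_opp. Qed.

Lemma norm_zero : norm A (zero A) = 0.
Proof. rewrite <- (scal_Czero (zero A)), norm_scal, Cmod_Czero. ring. Qed.

Lemma norm_opp (x : A) : norm A (opp A x) = norm A x.
Proof. rewrite opp_scal, norm_scal, Cmod_Copp, Cmod_Cone. ring. Qed.

Lemma norm_sub (x y : A) : norm A (sub A x y) <= norm A x + norm A y.
Proof. unfold sub. rewrite <- (norm_opp y). apply norm_triangle. Qed.

End Module.

(** * Deciding identities between non-commutative polynomials *)

Inductive aexp : Type :=
| AZero | AUnit | AVar (n : nat)
| AAdd (x y : aexp) | AOpp (x : aexp) | AScal (c : Cx) (x : aexp) | AMul (x y : aexp).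

(** A sum of monomials, each a coefficient with a word of variable indices; the empty word stands
    for the unit. *)
Definition cpoly := list (Cx * list nat).

Definition cp_scal (c : Cx) (p : cpoly) : cpoly := map (fun t => (Cmul c (fst t), snd t)) p.
Definition cp_mul1 (c : Cx) (w : list nat) (p : cpoly) : cpoly :=
  map (fun t => (Cmul c (fst t), w ++ snd t)) p.
Fixpoint cp_mul (p q : cpoly) : cpoly :=
  match p with [] => [] | (c, w) :: p' => cp_mul1 c w q ++ cp_mul p' q end.

Fixpoint cp_nf (x : aexp) : cpoly :=
  match x with
  | AZero => []
  | AUnit => [(Cone, [])]
  | AVar n => [(Cone, [n])]
  | AAdd x y => cp_nf x ++ cp_nf y
  | AOpp x => cp_scal (Copp Cone) (cp_nf x)
  | AScal c x => cp_scal c (cp_nf x)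
  | AMul x y => cp_mul (cp_nf x) (cp_nf y)
  end.

Fixpoint word_eqb (v w : list nat) : bool :=
  match v, w with
  | [], [] => true
  | m :: v', n :: w' => if Nat.eqb m n then word_eqb v' w' else false
  | _, _ => false
  end.

Fixpoint cp_insert (c : Cx) (w : list nat) (p : cpoly) : cpoly :=
  match p with
  | [] => [(c, w)]
  | (d, v) :: p' =>
      if word_eqb w v then (Cadd c d, v) :: p' else (d, v) :: cp_insert c w p'
  end.

Fixpoint cp_collect (p : cpoly) : cpoly :=
  match p with [] => [] | (c, w) :: p' => cp_insert c w (cp_collect p') end.

(** Equality of complex coefficients is not computable, so vanishing is a proposition, left as side
    conditions for [ring] or [field]. *)
Fixpoint cp_null (p : cpoly) : Prop :=
  match p with [] => True | (c, _) :: p' => c = Czero /\ cp_null p' end.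

(** Expressions without the unit can be normalised in an algebra that has none, with any value for
    [e]. *)
Fixpoint unit_free (x : aexp) : bool :=
  match x with
  | AUnit => false
  | AZero | AVar _ => true
  | AAdd x y | AMul x y => if unit_free x then unit_free y else false
  | AOpp x | AScal _ x => unit_free x
  end.

Section Reflect.
Variables (A : BanachStarAlgebra) (e : A) (env : list A).

Fixpoint adenote (x : aexp) : A :=
  match x with
  | AZero => zero A
  | AUnit => e
  | AVar n => nth n env (zero A)
  | AAdd x y => add A (adenote x) (adenote y)
  | AOpp x => opp A (adenote x)
  | AScal c x => scal A c (adenote x)
  | AMul x y => mul A (adenote x) (adenote y)
  end.

(** The inner match keeps a trailing factor [e] out of nonempty words, whose value is thus
    independent of [e]. *)
Fixpoint wdenote (w : list nat) : A :=
  match w with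
  | [] => e
  | n :: w' => match w' with
               | [] => nth n env (zero A)
               | _ => mul A (nth n env (zero A)) (wdenote w')
               end
  end.

Fixpoint cpdenote (p : cpoly) : A :=
  match p with
  | [] => zero A
  | (c, w) :: p' => add A (scal A c (wdenote w)) (cpdenote p')
  end.

Definition word_ok (w : list nat) : Prop := is_unit A e \/ w <> [].
Definition cp_ok (p : cpoly) : Prop := Forall (fun t => word_ok (snd t)) p.

Lemma wdenote_app v w : word_ok v -> word_ok w ->
  wdenote (v ++ w) = mul A (wdenote v) (wdenote w).
Proof.
  intros Hv Hw. induction v as [|n v IH].
  - destruct Hv as [U|[]]; [|reflexivity]. simpl. symmetry; apply U.
  - destruct v as [|m v].
    + destruct w as [|m w].
      * destruct Hw as [U|[]]; [|reflexivity]. simpl. symmetry; apply U.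
      * reflexivity.
    + change (mul A (nth n env (zero A)) (wdenote ((m :: v) ++ w))
        = mul A (mul A (nth n env (zero A)) (wdenote (m :: v))) (wdenote w)).
      rewrite IH by (right; discriminate). apply mul_assoc.
Qed.

Lemma cpdenote_app p q : cpdenote (p ++ q) = add A (cpdenote p) (cpdenote q).
Proof.
  induction p as [|[c w] p IH]; simpl.
  - now rewrite add_comm, add_zero.
  - now rewrite IH, add_assoc.
Qed.

Lemma cpdenote_scal c p : cpdenote (cp_scal c p) = scal A c (cpdenote p).
Proof.
  induction p as [|[d w] p IH]; simpl.
  - now rewrite scal_zero.
  - now rewrite IH, scal_addr, scal_mul.
Qed.

Lemma cpdenote_mul1 c w p : word_ok w -> cp_ok p ->
  cpdenote (cp_mul1 c w p) = mul A (scal A c (wdenote w)) (cpdenote p).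
Proof.
  intros Hw Hp. induction Hp as [|[d v] p Hv Hp IH]; simpl.
  - now rewrite mul_zero_r.
  - rewrite IH, mul_addr, wdenote_app by assumption. f_equal.
    rewrite <- scal_mulr, <- scal_mull, <- scal_mul. f_equal; cx; ring.
Qed.

Lemma cpdenote_mul p q : cp_ok p -> cp_ok q ->
  cpdenote (cp_mul p q) = mul A (cpdenote p) (cpdenote q).
Proof.
  intros Hp Hq. induction Hp as [|[c w] p Hw Hp IH]; simpl.
  - now rewrite mul_zero_l.
  - now rewrite cpdenote_app, IH, mul_addl, cpdenote_mul1.
Qed.

Lemma word_ok_app v w : word_ok v -> word_ok w -> word_ok (v ++ w).
Proof.
  intros [U|Hv] Hw; [now left|]. right. destruct v; [now destruct Hv|discriminate].
Qed.

Lemma cp_ok_scal c p : cp_ok p -> cp_ok (cp_scal c p).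
Proof. intros H; induction H; constructor; assumption. Qed.

Lemma cp_ok_mul p q : cp_ok p -> cp_ok q -> cp_ok (cp_mul p q).
Proof.
  intros Hp Hq; induction Hp as [|[c w] p Hw Hp IH]; simpl; [constructor|].
  apply Forall_app; split; [|exact IH].
  clear IH Hp p. induction Hq as [|[d v] q Hv Hq IH]; constructor; [|exact IH].
  now apply word_ok_app.
Qed.

Lemma cp_ok_nf x : is_unit A e \/ unit_free x = true -> cp_ok (cp_nf x).
Proof.
  assert (K : forall a b : bool, is_unit A e \/ (if a then b else false) = true ->
    (is_unit A e \/ a = true) /\ (is_unit A e \/ b = true)).
  { intros [] [] []; split; auto; discriminate. }
  induction x; simpl; intros H.
  - constructor.
  - destruct H as [H|H]; [|discriminate]. constructor; [left; exact H|constructor].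
  - constructor; [right; discriminate|constructor].
  - apply K in H as [H1 H2]. apply Forall_app; split; [now apply IHx1|now apply IHx2].
  - now apply cp_ok_scal, IHx.
  - now apply cp_ok_scal, IHx.
  - apply K in H as []. apply cp_ok_mul; auto.
Qed.

Lemma adenote_nf x : is_unit A e \/ unit_free x = true -> adenote x = cpdenote (cp_nf x).
Proof.
  assert (K : forall a b : bool, is_unit A e \/ (if a then b else false) = true ->
    (is_unit A e \/ a = true) /\ (is_unit A e \/ b = true)).
  { intros [] [] []; split; auto; discriminate. }
  induction x; simpl; intros H.
  - reflexivity.
  - now rewrite scal_one, add_zero.
  - now rewrite scal_one, add_zero.
  - apply K in H as []. rewrite cpdenote_app, IHx1, IHx2 by assumption. reflexivity.
  - rewrite cpdenote_scal, IHx by assumption. apply opp_scal.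
  - rewrite cpdenote_scal, IHx by assumption. reflexivity.
  - apply K in H as []. rewrite cpdenote_mul, IHx1, IHx2 by (try apply cp_ok_nf; assumption).
    reflexivity.
Qed.

Lemma word_eqb_eq v w : word_eqb v w = true -> v = w.
Proof.
  revert w; induction v as [|m v IH]; destruct w as [|n w]; simpl; try discriminate; auto.
  destruct (Nat.eqb m n) eqn:E; [|discriminate]. intros H. apply Nat.eqb_eq in E.
  f_equal; auto.
Qed.

Lemma cpdenote_insert c w p :
  cpdenote (cp_insert c w p) = add A (scal A c (wdenote w)) (cpdenote p).
Proof.
  induction p as [|[d v] p IH]; simpl; [reflexivity|].
  destruct (word_eqb w v) eqn:E; simpl.
  - apply word_eqb_eq in E as ->. now rewrite scal_addl, add_assoc.
  - rewrite IH, !add_assoc. f_equal. apply add_comm.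
Qed.

Lemma cpdenote_collect p : cpdenote (cp_collect p) = cpdenote p.
Proof.
  induction p as [|[c w] p IH]; simpl; [reflexivity|]. now rewrite cpdenote_insert, IH.
Qed.

Lemma cp_null_denote p : cp_null p -> cpdenote p = zero A.
Proof.
  induction p as [|[c w] p IH]; simpl; [reflexivity|].
  intros [-> H]. now rewrite IH, scal_Czero, add_zero.
Qed.

(** Only soundness is at stake: once the collected coefficients of the difference vanish, both sides
    agree, in whatever order the monomials come. *)
Lemma reflect_eq x y :
  is_unit A e \/ unit_free (AAdd x (AOpp y)) = true ->
  cp_null (cp_collect (cp_nf (AAdd x (AOpp y)))) -> adenote x = adenote y.
Proof.
  intros U H. apply cp_null_denote in H. rewrite cpdenote_collect, <- adenote_nf in H by exact U.
  simpl in H. apply (add_cancel A (opp A (adenote y))).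
  now rewrite !(add_comm A (opp A _)), H, add_opp.
Qed.

End Reflect.

(** * Reification and the tactic [alg] *)

Ltac list_find x l :=
  lazymatch l with
  | x :: _ => constr:(O)
  | _ :: ?l' => let n := list_find x l' in constr:(S n)
  end.

(** The first branch succeeds only if [x] already occurs; otherwise [list_find] fails and [match]
    backtracks to the insertion. *)
Ltac list_add x l :=
  match l with
  | _ => let n := list_find x l in l
  | _ => constr:(x :: l)
  end.

Ltac alg_vars A e t l :=
  lazymatch t with
  | zero A => l
  | e => l
  | add A ?x ?y => let l := alg_vars A e x l in alg_vars A e y l
  | mul A ?x ?y => let l := alg_vars A e x l in alg_vars A e y l
  | opp A ?x => alg_vars A e x l
  | scal A _ ?x => alg_vars A e x l
  | _ => list_add t l
  end.

Ltac alg_reify A e l t :=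
  lazymatch t with
  | zero A => constr:(AZero)
  | e => constr:(AUnit)
  | add A ?x ?y => let x := alg_reify A e l x in let y := alg_reify A e l y in constr:(AAdd x y)
  | mul A ?x ?y => let x := alg_reify A e l x in let y := alg_reify A e l y in constr:(AMul x y)
  | opp A ?x => let x := alg_reify A e l x in constr:(AOpp x)
  | scal A ?c ?x => let x := alg_reify A e l x in constr:(AScal c x)
  | _ => let n := list_find t l in constr:(AVar n)
  end.

Ltac alg_core A e U :=
  unfold sub;
  lazymatch goal with
  | |- ?x = ?y =>
    let l := alg_vars A e x (@nil (car A)) in
    let l := alg_vars A e y l in
    let p := alg_reify A e l x in
    let q := alg_reify A e l y in
    change (adenote A e l p = adenote A e l q);
    apply reflect_eq;
    [ U
    | cbv [cp_null cp_collect cp_nf cp_insert cp_scal cp_mul cp_mul1 map app fst snd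
        word_eqb Nat.eqb] ]
  end.

(** When no unit is in the context, [zero A] serves as a dummy [e] and unit-freeness is checked by
    computation. The coefficient goals stay open, so that [field] can treat those with divisions. *)
Ltac alg_pre :=
  unfold sub;
  lazymatch goal with
  | He : is_unit ?A ?e |- @eq (car ?A) _ _ => alg_core A e ltac:(left; exact He)
  | |- @eq (car ?A) _ _ => alg_core A (zero A) ltac:(right; reflexivity)
  end.

Ltac alg := alg_pre; repeat split; cx; ring.

(** * Real estimates for geometric sequences *)

Lemma pow_small (rho eps : R) : 0 <= rho < 1 -> 0 < eps ->
  exists n, forall m, (n <= m)%nat -> rho ^ m < eps.
Proof.
  intros Hr He. destruct (pow_lt_1_zero rho) with (y := eps) as [n Hn]; [|exact He|].
  - rewrite Rabs_pos_eq; lra.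
  - exists n; intros m Hm. specialize (Hn m Hm).
    rewrite Rabs_pos_eq in Hn; [exact Hn|apply pow_le; lra].
Qed.

Lemma geom_le_0 (K rho t : R) : 0 <= rho < 1 -> (forall n, t <= K * rho ^ n) -> t <= 0.
Proof.
  intros Hr H. destruct (Rle_or_lt t 0) as [|Ht]; [assumption|exfalso].
  assert (HK : 0 < K).
  { specialize (H 0%nat); simpl in H; lra. }
  destruct (pow_small rho (t / K)) as [n Hn]; [assumption|now apply Rdiv_lt_0_compat|].
  specialize (Hn n (le_n n)). specialize (H n).
  apply (Rmult_lt_compat_l K) in Hn; [|exact HK].
  replace (K * (t / K)) with t in Hn by (field; lra). lra.
Qed.

Lemma bernoulli_sub (d : R) (n : nat) : 0 <= d <= 1 -> 1 - INR n * d <= (1 - d) ^ n.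
Proof.
  intros Hd. induction n as [|n IH]; [simpl; lra|].
  rewrite S_INR. simpl.
  assert (0 <= INR n) by apply pos_INR.
  assert ((1 - d) * (1 - INR n * d) <= (1 - d) * (1 - d) ^ n)
    by (apply Rmult_le_compat_l; lra).
  assert (0 <= INR n * (d * d)) by (apply Rmult_le_pos; nra). nra.
Qed.

(** A root up to inequality: [rho = 1 - d] works by Bernoulli, since [n * d] is at most
    [1 - Rmax q 0]. The 2 in the denominator of [d] keeps [rho] positive. *)
Lemma root_between (q : R) (n : nat) : q < 1 -> exists rho, 0 < rho < 1 /\ q <= rho ^ n.
Proof.
  intros Hq. assert (Hn : 0 <= INR n) by apply pos_INR.
  set (d := (1 - Rmax q 0) / (INR n + 2)).
  assert (Hm : 0 <= Rmax q 0 < 1).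
  { split; [apply Rmax_r|apply Rmax_lub_lt; lra]. }
  assert (E : d * (INR n + 2) = 1 - Rmax q 0) by (unfold d; field; lra).
  assert (Hd : 0 < d) by (apply Rdiv_lt_0_compat; lra).
  exists (1 - d). split; [nra|].
  apply Rle_trans with (2 := bernoulli_sub d n ltac:(nra)).
  pose proof (Rmax_l q 0). nra.
Qed.

(** * Spectral theory in a unital Banach star-algebra *)

Declare Scope alg_scope.
Delimit Scope alg_scope with alg.
Bind Scope alg_scope with car.
Arguments norm _ _%_alg_scope.

Section Unital.
Variables (B : BanachStarAlgebra) (e : B).
Hypothesis He : is_unit B e.

Local Notation "x + y" := (add B x y) : alg_scope.
Local Notation "x * y" := (mul B x y) : alg_scope.
Local Notation "- x" := (opp B x) : alg_scope.
Local Notation "x - y" := (sub B x y) : alg_scope.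
Local Notation "c *: x" := (scal B c x) (at level 40) : alg_scope.
Local Notation "0" := (zero B) : alg_scope.
Local Notation "x ^*" := (star B x) (at level 2, format "x ^*") : alg_scope.
Local Notation N := (norm B).
Local Open Scope alg_scope.

Lemma mul_e_l (x : B) : e * x = x.
Proof. apply He. Qed.

Lemma mul_e_r (x : B) : x * e = x.
Proof. apply He. Qed.

Lemma star_e : e^* = e.
Proof.
  rewrite <- (mul_e_r (e^*)). rewrite <- (star_star B e) at 2. rewrite <- star_mul, mul_e_r.
  apply star_star.
Qed.

Lemma norm_eq0_le (x : B) : (N x <= 0)%R -> x = 0.
Proof. intros H. apply norm_eq0. pose proof (norm_nonneg B x). lra. Qed.

Lemma sub_eq0 (x y : B) : x - y = 0 -> x = y.
Proof.
  intros H. replace x with ((x - y) + y) by alg. rewrite H. alg.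
Qed.

(** * Invertible elements *)

Definition isinv (x y : B) : Prop := x * y = e /\ y * x = e.
Definition Inv (x : B) : Prop := exists y, isinv x y.

Lemma isinv_sym (x y : B) : isinv x y -> isinv y x.
Proof. intros []; split; assumption. Qed.

Lemma left_right_inv (x y z : B) : y * x = e -> x * z = e -> y = z.
Proof.
  intros H1 H2. rewrite <- (mul_e_r y), <- H2, mul_assoc, H1. apply mul_e_l.
Qed.

Lemma isinv_unique (x y z : B) : isinv x y -> isinv x z -> y = z.
Proof. intros [] []; now apply (left_right_inv x). Qed.

Lemma Inv_of_left_right (x y z : B) : y * x = e -> x * z = e -> Inv x.
Proof.
  intros H1 H2. exists z. split; [exact H2|]. now rewrite <- (left_right_inv x y z).
Qed.

Lemma isinv_e : isinv e e.
Proof. split; apply mul_e_l. Qed.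

Lemma isinv_mul (a b c d : B) : isinv a b -> isinv c d -> isinv (a * c) (d * b).
Proof.
  intros [H1 H2] [H3 H4]; split.
  - rewrite mul_assoc, <- (mul_assoc B a), H3, mul_e_r. exact H1.
  - rewrite mul_assoc, <- (mul_assoc B d), H2, mul_e_r. exact H4.
Qed.

Lemma Inv_mul (a c : B) : Inv a -> Inv c -> Inv (a * c).
Proof. intros [b Hb] [d Hd]. exists (d * b). now apply isinv_mul. Qed.

(** If [c] inverts [a * b = b * a], then [c * b] is a left and [b * c] a right inverse of [a]. This
    supplies the inclusion of [p(sp(x))] in [sp(p(x))] for polynomials [p]. *)
Lemma Inv_factor (a b : B) : a * b = b * a -> Inv (a * b) -> Inv a.
Proof.
  intros Hab [c [H1 H2]]. apply (Inv_of_left_right a (c * b) (b * c)).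
  - now rewrite <- mul_assoc, <- Hab.
  - now rewrite mul_assoc.
Qed.

Lemma isinv_commute (x y z : B) : isinv x y -> z * x = x * z -> z * y = y * z.
Proof.
  intros [H1 H2] H. rewrite <- (mul_e_l (z * y)), <- H2.
  rewrite <- mul_assoc, (mul_assoc B x z y), <- H, <- (mul_assoc B z x y), H1, mul_e_r.
  reflexivity.
Qed.

Lemma isinv_star (x y : B) : isinv x y -> isinv (x^*) (y^*).
Proof. intros [H1 H2]; split; now rewrite <- star_mul, ?H1, ?H2, star_e. Qed.

Lemma isinv_scal (c : Cx) (x y : B) : c <> Czero -> isinv x y -> isinv (c *: x) (Cinv c *: y).
Proof.
  intros Hc [H1 H2]. pose proof (Cmul_Cinv c Hc) as E.
  split; rewrite <- scal_mull, <- scal_mulr, <- scal_mul, ?H1, ?H2.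
  - now rewrite E, scal_one.
  - rewrite (Cx_ext (Cmul (Cinv c) c) (Cmul c (Cinv c))) by (simpl; ring).
    now rewrite E, scal_one.
Qed.

Lemma Inv_scal (c : Cx) (x : B) : c <> Czero -> Inv x -> Inv (c *: x).
Proof. intros Hc [y H]. exists (Cinv c *: y). now apply isinv_scal. Qed.

Lemma Inv_scal_inv (c : Cx) (x : B) : c <> Czero -> Inv (c *: x) -> Inv x.
Proof.
  intros Hc H. rewrite <- (scal_one B x), <- (Cmul_Cinv c Hc).
  rewrite (Cx_ext (Cmul c (Cinv c)) (Cmul (Cinv c) c)), scal_mul by (simpl; ring).
  apply Inv_scal; [|exact H].
  intros E. pose proof (Cmul_Cinv c Hc) as F. rewrite E in F.
  apply (f_equal Re) in F; simpl in F. lra.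
Qed.

Lemma Inv_opp (x : B) : Inv x -> Inv (- x).
Proof.
  rewrite opp_scal. apply Inv_scal. intros H; apply (f_equal Re) in H; simpl in H; lra.
Qed.

Lemma Inv_e : Inv e.
Proof. exists e; exact isinv_e. Qed.

Lemma Inv_star (x : B) : Inv x -> Inv (x^*).
Proof. intros [y H]. exists (y^*). now apply isinv_star. Qed.

(** * Powers and convergence *)

Fixpoint mpow (x : B) (n : nat) : B :=
  match n with O => e | S n' => x * mpow x n' end.

Lemma mpow_add (x : B) (m n : nat) : mpow x (m + n) = mpow x m * mpow x n.
Proof.
  induction m as [|m IH]; simpl.
  - now rewrite mul_e_l.
  - now rewrite IH, mul_assoc.
Qed.

Lemma mpow_commute (x z : B) (n : nat) : z * x = x * z -> z * mpow x n = mpow x n * z.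
Proof.
  intros H. induction n as [|n IH]; simpl.
  - now rewrite mul_e_l, mul_e_r.
  - now rewrite mul_assoc, H, <- mul_assoc, IH, mul_assoc.
Qed.

Lemma mpow_S_r (x : B) (n : nat) : mpow x (S n) = mpow x n * x.
Proof. simpl. apply mpow_commute. reflexivity. Qed.

Lemma mpow_star (x : B) (n : nat) : mpow (x^*) n = (mpow x n)^*.
Proof.
  induction n as [|n IH].
  - simpl. now rewrite star_e.
  - rewrite (mpow_S_r x). simpl. now rewrite IH, star_mul.
Qed.

Lemma norm_mpow_scal (c : Cx) (x : B) (n : nat) :
  (N (mpow (c *: x) n) = Cmod c ^ n * N (mpow x n))%R.
Proof.
  (* The scalar [d] is the power of [c], of which only the modulus matters. *)
  assert (H : exists d, Cmod d = (Cmod c ^ n)%R /\ mpow (c *: x) n = d *: mpow x n).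
  { induction n as [|n [d [H1 H2]]].
    - exists Cone. split; [apply Cmod_Cone|]. simpl. now rewrite scal_one.
    - exists (Cmul c d). split; [now rewrite Cmod_mul, H1|].
      simpl. now rewrite H2, scal_mul, <- scal_mulr, <- scal_mull, <- !scal_mul,
        (Cx_ext (Cmul d c) (Cmul c d)) by (simpl; ring). }
  destruct H as [d [H1 H2]]. now rewrite H2, norm_scal, H1.
Qed.

Lemma geometric_limit (u : nat -> B) (C rho : R) : (0 <= rho < 1)%R ->
  (forall n, (N (u (S n) - u n) <= C * rho ^ n)%R) ->
  exists l, forall n, (N (u n - l) <= C / (1 - rho) * rho ^ n)%R.
Proof.
  intros Hr Hu.
  assert (HC : (0 <= C)%R).
  { specialize (Hu 0%nat). pose proof (norm_nonneg B (u 1%nat - u 0%nat)). simpl in Hu. lra. }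
  set (K := (C / (1 - rho))%R).
  assert (HK : (0 <= K)%R).
  { apply Rmult_le_pos; [lra|]. left; apply Rinv_0_lt_compat; lra. }
  assert (EK : (C = K * (1 - rho))%R) by (unfold K; field; lra).
  (* The bound is the exact partial geometric sum, the form in which the induction on [k] closes. *)
  assert (H : forall n k, (N (u n - u (n + k)%nat) <= K * (rho ^ n - rho ^ (n + k)))%R).
  { intros n k; induction k as [|k IH].
    - rewrite Nat.add_0_r. replace (u n - u n) with (0 : B) by alg.
      rewrite norm_zero; lra.
    - replace (u n - u (n + S k)%nat)
        with ((u n - u (n + k)%nat) - (u (n + S k)%nat - u (n + k)%nat)) by alg.
      eapply Rle_trans; [apply norm_sub|].
      replace (n + S k)%nat with (S (n + k)) by lia.
      specialize (Hu (n + k)%nat). simpl. rewrite EK in Hu. nra. }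
  assert (H' : forall n k, (N (u n - u (n + k)%nat) <= K * rho ^ n)%R).
  { intros n k. eapply Rle_trans; [apply H|].
    assert (0 <= rho ^ (n + k))%R by (apply pow_le; lra). nra. }
  destruct (complete B u) as [l Hl].
  { intros eps Heps.
    destruct (pow_small rho (eps / (K + 1))) as [n0 Hn0]; [assumption|apply Rdiv_lt_0_compat; lra|].
    assert (G : forall n k, (n0 <= n)%nat -> (N (u n - u (n + k)%nat) < eps)%R).
    { intros n k Hn. eapply Rle_lt_trans; [apply H'|]. specialize (Hn0 n Hn).
      apply (Rmult_lt_compat_l (K + 1)) in Hn0; [|lra].
      replace ((K + 1) * (eps / (K + 1)))%R with eps in Hn0 by (field; lra).
      assert (0 <= rho ^ n)%R by (apply pow_le; lra). lra. }
    exists n0. intros m n Hm Hn. change (N (u m - u n) < eps)%R.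
    destruct (Nat.le_ge_cases m n).
    - replace n with (m + (n - m))%nat by lia. apply G; lia.
    - rewrite <- norm_opp. replace (- (u m - u n)) with (u n - u m) by alg.
      replace m with (n + (m - n))%nat by lia. apply G; lia. }
  exists l. intros n. apply le_epsilon. intros eps Heps.
  destruct (Hl eps Heps) as [n1 Hn1]. specialize (Hn1 (n + n1)%nat ltac:(lia)).
  change (N (u (n + n1)%nat - l) < eps)%R in Hn1.
  replace (u n - l) with ((u n - u (n + n1)%nat) + (u (n + n1)%nat - l)) by alg.
  eapply Rle_trans; [apply norm_triangle|]. specialize (H' n n1). lra.
Qed.

Lemma eq0_of_geom (x : B) (K rho : R) : (0 <= rho < 1)%R ->
  (forall n, (N x <= K * rho ^ n)%R) -> x = 0.
Proof. intros Hr H. apply norm_eq0_le. now apply (geom_le_0 K rho). Qed.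

(** Spectral radius less than 1, expressed by geometric decay of the powers and so without roots or
    infima. *)
Definition small (x : B) : Prop :=
  exists C rho, (0 <= C)%R /\ (0 < rho < 1)%R /\ forall n, (N (mpow x n) <= C * rho ^ n)%R.

(** Choose [rho] with [N (mpow x (S n)) <= rho ^ S n]. A constant [C] handles the exponents up to
    [n]; a larger exponent is lowered by [S n] at the cost of the factor [rho ^ S n]. *)
Lemma small_of_pow_lt1 (x : B) (n : nat) : (N (mpow x (S n)) < 1)%R -> small x.
Proof.
  intros H. destruct (root_between (N (mpow x (S n))) (S n) H) as [rho [Hr Hq]].
  assert (HC : forall m, exists C, (0 <= C)%R /\
    forall k, (k <= m)%nat -> (N (mpow x k) <= C * rho ^ k)%R).
  { intros m; induction m as [|m [C [HC1 HC2]]].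
    - exists (N e). split; [apply norm_nonneg|]. intros k Hk. replace k with 0%nat by lia.
      simpl. lra.
    - assert (P : (0 < rho ^ S m)%R) by (apply pow_lt; lra).
      pose proof (norm_nonneg B (mpow x (S m))).
      set (d := (N (mpow x (S m)) / rho ^ S m)%R).
      assert (0 <= d)%R by (apply Rmult_le_pos; [assumption|left; now apply Rinv_0_lt_compat]).
      exists (C + d)%R. split; [lra|]. intros k Hk.
      assert (0 < rho ^ k)%R by (apply pow_lt; lra).
      destruct (Nat.eq_dec k (S m)) as [->|].
      + replace (N (mpow x (S m))) with (d * rho ^ S m)%R by (unfold d; field; lra). nra.
      + specialize (HC2 k ltac:(lia)). nra. }
  destruct (HC n) as [C [HC1 HC2]]. exists C, rho. split; [exact HC1|]. split; [exact Hr|].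
  intros k. induction k as [k IH] using Wf_nat.lt_wf_ind.
  destruct (Compare_dec.le_lt_dec k n) as [|Hk]; [now apply HC2|].
  replace k with (S n + (k - S n))%nat by lia. rewrite mpow_add, pow_add.
  eapply Rle_trans; [apply norm_mul|].
  specialize (IH (k - S n)%nat ltac:(lia)).
  pose proof (norm_nonneg B (mpow x (S n))). pose proof (norm_nonneg B (mpow x (k - S n))).
  replace (C * (rho ^ S n * rho ^ (k - S n)))%R with (rho ^ S n * (C * rho ^ (k - S n)))%R by ring.
  apply Rmult_le_compat; assumption.
Qed.

Lemma small_of_norm (x : B) : (N x < 1)%R -> small x.
Proof. intros H. apply (small_of_pow_lt1 x 0). simpl. now rewrite mul_e_r. Qed.

Lemma small_pow_lt (x : B) (eps : R) : small x -> (0 < eps)%R ->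
  exists n, forall m, (n <= m)%nat -> (N (mpow x m) < eps)%R.
Proof.
  intros [C [rho [HC [Hr H]]]] Heps.
  destruct (pow_small rho (eps / (C + 1))) as [n Hn]; [lra|apply Rdiv_lt_0_compat; lra|].
  exists n. intros m Hm. eapply Rle_lt_trans; [apply H|]. specialize (Hn m Hm).
  apply (Rmult_lt_compat_l (C + 1)) in Hn; [|lra].
  replace ((C + 1) * (eps / (C + 1)))%R with eps in Hn by (field; lra).
  assert (0 <= rho ^ m)%R by (apply pow_le; lra). lra.
Qed.

Lemma small_scal (c : Cx) (x : B) : (Cmod c <= 1)%R -> small x -> small (c *: x).
Proof.
  intros Hc [C [rho [HC [Hr H]]]]. exists C, rho. repeat split; try lra.
  intros n. rewrite norm_mpow_scal. specialize (H n).
  pose proof (norm_nonneg B (mpow x n)).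
  assert (0 <= Cmod c ^ n <= 1)%R.
  { pose proof (Cmod_nonneg c). split; [now apply pow_le|].
    rewrite <- (pow1 n). apply pow_incr; lra. }
  nra.
Qed.

(** Stretching by [t] replaces the rate [rho] by [t * rho = (1 + rho) / 2], still below 1. *)
Lemma small_open (x : B) : small x -> exists t, (1 < t)%R /\ small (RtoC t *: x).
Proof.
  intros [C [rho [HC [Hr H]]]].
  set (t := ((1 + rho) / 2 / rho)%R).
  assert (Et : (t * rho = (1 + rho) / 2)%R) by (unfold t; field; lra).
  assert (Ht : (1 < t)%R) by nra.
  exists t. split; [exact Ht|].
  exists C, (t * rho)%R. repeat split; [exact HC|nra|nra|].
  intros n. rewrite norm_mpow_scal, Cmod_RtoC, Rabs_pos_eq, Rpow_mult_distr by lra.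
  assert (0 <= t ^ n)%R by (apply pow_le; lra). specialize (H n). nra.
Qed.

(** Since [(y x)^(n+1) = y (x y)^n x], it suffices that the norm of [(x y)^n] outweighs the factor
    [N x * N y]. *)
Lemma small_comm (x y : B) : small (x * y) -> small (y * x).
Proof.
  intros H.
  pose proof (norm_nonneg B x) as Hx. pose proof (norm_nonneg B y) as Hy.
  destruct (small_pow_lt (x * y) (/ (N x * N y + 1)) H) as [n Hn].
  { apply Rinv_0_lt_compat. nra. }
  specialize (Hn n (le_n n)).
  assert (E : mpow (y * x) (S n) = y * mpow (x * y) n * x).
  { clear - He. induction n as [|n IH].
    - simpl. alg.
    - change (mpow (y * x) (S (S n))) with ((y * x) * mpow (y * x) (S n)).
      rewrite IH. simpl. alg. }
  apply (small_of_pow_lt1 _ n). rewrite E.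
  pose proof (norm_nonneg B (mpow (x * y) n)).
  eapply Rle_lt_trans; [apply norm_mul|].
  assert (N (y * mpow (x * y) n) <= N y * N (mpow (x * y) n))%R by apply norm_mul.
  apply (Rmult_lt_compat_l (N x * N y + 1)) in Hn; [|nra].
  rewrite Rinv_r in Hn by nra. nra.
Qed.

Lemma neumann (x : B) : small x -> Inv (e - x).
Proof.
  intros [C [rho [HC [Hr H]]]].
  (* The partial sums of the Neumann series, in Horner form. *)
  assert (Hex : exists s : nat -> B, s 0%nat = 0 /\ forall n, s (S n) = e + x * s n).
  { exists (fix s n := match n with O => 0 | S n' => e + x * s n' end). split; reflexivity. }
  destruct Hex as [s [Hs0 HsS]].
  assert (Hs : forall n, s (S n) - s n = mpow x n).
  { intros n. induction n as [|n IH]; [rewrite HsS, Hs0; simpl; alg|].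
    simpl mpow. rewrite (HsS (S n)), <- IH, HsS. alg. }
  assert (H1 : forall n, (e - x) * s n = e - mpow x n).
  { intros n. transitivity (s n - (s (S n) - e)); [rewrite HsS; alg|].
    rewrite <- Hs. alg. }
  assert (Hc : forall n, x * s n = s n * x).
  { intros n; induction n as [|n IH]; [rewrite Hs0; alg|].
    rewrite HsS, mul_addr. rewrite IH at 1. alg. }
  destruct (geometric_limit s C rho) as [l Hl]; [lra| |].
  { intros n. rewrite Hs. apply H. }
  set (K := (C / (1 - rho))%R) in *.
  assert (Hn : forall n, (0 <= rho ^ n)%R) by (intros; apply pow_le; lra).
  pose proof (norm_nonneg B (e - x)) as Hx.
  (* The defect of [l] as an inverse splits into the power [mpow x n] and the error [s n - l] times
     [e - x]; both decay like [rho ^ n]. *)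
  exists l. split; apply sub_eq0; apply (eq0_of_geom _ (N (e - x) * K + C) rho); try lra;
    intros n; specialize (H n); specialize (Hl n).
  - replace ((e - x) * l - e) with ((e - x) * s n - e - (e - x) * (s n - l)) by alg.
    rewrite H1. eapply Rle_trans; [apply norm_sub|].
    replace (e - mpow x n - e) with (- mpow x n) by alg. rewrite norm_opp.
    assert (N ((e - x) * (s n - l)) <= N (e - x) * N (s n - l))%R by apply norm_mul.
    assert (N (e - x) * N (s n - l) <= N (e - x) * (K * rho ^ n))%R
      by (apply Rmult_le_compat_l; assumption). lra.
  - replace (l * (e - x) - e) with (s n * (e - x) - e - (s n - l) * (e - x)) by alg.
    replace (s n * (e - x)) with ((e - x) * s n)
      by (transitivity (s n - x * s n); [alg|rewrite Hc; alg]).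
    rewrite H1. eapply Rle_trans; [apply norm_sub|].
    replace (e - mpow x n - e) with (- mpow x n) by alg. rewrite norm_opp.
    assert (N ((s n - l) * (e - x)) <= N (s n - l) * N (e - x))%R by apply norm_mul.
    assert (N (s n - l) * N (e - x) <= (K * rho ^ n) * N (e - x))%R
      by (apply Rmult_le_compat_r; assumption). lra.
Qed.
(** * The spectral radius theorem *)

(** Compactness of [[a, b]], with [Q x M] read as [M] bounding a quantity at [x]. The supremum [t]
    of the points reachable with one bound must be [b], because the local bound at [t] carries
    further. *)
Lemma locally_bounded_bounded (a b : R) (Q : R -> R -> Prop) : (a <= b)%R ->
  (forall x M M', Q x M -> (M <= M')%R -> Q x M') ->
  (forall x, (a <= x <= b)%R -> exists d M, (0 < d)%R /\
     forall y, (a <= y <= b)%R -> (Rabs (y - x) < d)%R -> Q y M) ->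
  exists M, forall x, (a <= x <= b)%R -> Q x M.
Proof.
  intros Hab Hmono Hloc.
  set (S := fun t => (a <= t <= b)%R /\ exists M, forall x, (a <= x <= t)%R -> Q x M).
  assert (Sa : S a).
  { split; [lra|]. destruct (Hloc a ltac:(lra)) as [d [M [Hd H]]].
    exists M. intros x Hx. apply H; [lra|]. replace (x - a)%R with 0%R by lra.
    rewrite Rabs_R0; exact Hd. }
  destruct (completeness S) as [t [Ht1 Ht2]].
  { exists b. intros x [Hx _]; lra. }
  { exists a; exact Sa. }
  assert (Hat : (a <= t)%R) by now apply Ht1.
  assert (Htb : (t <= b)%R) by (apply Ht2; intros x [Hx _]; lra).
  destruct (Hloc t ltac:(lra)) as [d [M [Hd H]]].
  assert (Hs : exists s, S s /\ (t - d < s)%R).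
  { apply NNPP. intros Hn. assert (t <= t - d)%R; [|lra].
    apply Ht2. intros s Hs. apply Rnot_lt_le. intros Hlt. apply Hn. now exists s. }
  destruct Hs as [s [[Hs [M' HM']] Hsd]].
  assert (Hst : (s <= t)%R) by (apply Ht1; split; [exact Hs|now exists M']).
  (* A point beyond [t] unless [b] intervenes; as [r] lies in [S], it cannot exceed [t], so
     [r = b]. *)
  set (r := Rmin b (t + d / 2)).
  assert (Hr : (r <= b)%R /\ (r <= t + d / 2)%R) by (split; [apply Rmin_l|apply Rmin_r]).
  assert (HSr : S r).
  { split; [split; [apply Rmin_glb; lra|lra]|]. exists (Rmax M M'). intros x Hx.
    destruct (Rle_or_lt x s).
    - apply (Hmono x M'); [apply HM'; lra|apply Rmax_r].
    - apply (Hmono x M); [|apply Rmax_l]. apply H; [lra|].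
      apply Rabs_def1; lra. }
  assert (Hrb : r = b).
  { assert (r <= t)%R by (now apply Ht1). unfold r, Rmin in *.
    destruct (Rle_dec b (t + d / 2)); lra. }
  rewrite Hrb in HSr. exact (proj2 HSr).
Qed.

Definition cis (t : R) : Cx := mkC (cos t) (sin t).

Lemma circle_cis (z : Cx) : Cmod z = 1%R -> exists t, (- PI <= t <= PI)%R /\ z = cis t.
Proof.
  intros H. pose proof (Cmod_sq z) as S. rewrite H in S.
  assert (Hr : (-1 <= Re z <= 1)%R) by nra.
  pose proof (acos_bound (Re z)).
  assert (Hs : sin (acos (Re z)) = Rabs (Im z)).
  { rewrite sin_acos by exact Hr. rewrite <- sqrt_Rsqr_abs. f_equal. unfold Rsqr; lra. }
  unfold Rabs in Hs; destruct (Rcase_abs (Im z)).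
  - exists (- acos (Re z))%R. split; [lra|]. unfold cis. rewrite cos_neg, sin_neg, cos_acos by lra.
    cx; lra.
  - exists (acos (Re z)). split; [lra|]. unfold cis. rewrite cos_acos by lra. cx; lra.
Qed.

Definition Csub (z w : Cx) : Cx := Cadd z (Copp w).

Lemma cis_continuous (t eta : R) : (0 < eta)%R ->
  exists d, (0 < d)%R /\ forall s, (Rabs (s - t) < d)%R -> (Cmod (Csub (cis s) (cis t)) < eta)%R.
Proof.
  intros He'.
  assert (K : forall f, continuity f -> exists d, (0 < d)%R /\
     forall s, (Rabs (s - t) < d)%R -> (Rabs (f s - f t) < eta / 2)%R).
  { intros f Hf. destruct (Hf t (eta / 2)%R ltac:(lra)) as [d [Hd H]].
    exists d. split; [exact Hd|]. intros s Hs.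
    destruct (Req_dec s t) as [->|Hst].
    - replace (f t - f t)%R with 0%R by ring. rewrite Rabs_R0; lra.
    - apply H. split; [split; [exact I|auto]|exact Hs]. }
  destruct (K cos continuity_cos) as [d1 [Hd1 H1]].
  destruct (K sin continuity_sin) as [d2 [Hd2 H2]].
  exists (Rmin d1 d2). split; [now apply Rmin_glb_lt|]. intros s Hs.
  specialize (H1 s (Rlt_le_trans _ _ _ Hs (Rmin_l _ _))).
  specialize (H2 s (Rlt_le_trans _ _ _ Hs (Rmin_r _ _))).
  eapply Rle_lt_trans; [apply Cmod_le_add|]. simpl.
  change (cos s + - cos t)%R with (cos s - cos t)%R.
  change (sin s + - sin t)%R with (sin s - sin t)%R. lra.
Qed.

(** The resolvent identity [g - h = (a - b) g y h]. *)
Lemma resolvent_norm (y g h : B) (a b : Cx) :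
  isinv (e - a *: y) g -> isinv (e - b *: y) h ->
  (N (g - h) <= Cmod (Csub a b) * N g * N y * N h)%R.
Proof.
  intros [_ Hg] [Hh _].
  assert (E : g - h = Csub a b *: (g * y * h)).
  { transitivity (g * ((e - b *: y) * h) - (g * (e - a *: y)) * h).
    - rewrite Hg, Hh. alg.
    - unfold Csub. alg. }
  rewrite E, norm_scal, !Rmult_assoc. apply Rmult_le_compat_l; [apply Cmod_nonneg|].
  rewrite <- Rmult_assoc. eapply Rle_trans; [apply norm_mul|].
  apply Rmult_le_compat_r; [apply norm_nonneg|apply norm_mul].
Qed.

(** Near a point with inverse [h], the resolvent identity bounds the inverses by [2 * N h];
    compactness of the circle, parametrised by [[-PI, PI]], makes the bound uniform. *)
Lemma inverse_bounded_on_circle (y : B) :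
  (forall z, Cmod z = 1%R -> Inv (e - z *: y)) ->
  exists M, (0 <= M)%R /\ forall z g, Cmod z = 1%R -> isinv (e - z *: y) g -> (N g <= M)%R.
Proof.
  intros Hinv.
  assert (Hc : forall t, Cmod (cis t) = 1%R).
  { intros t. unfold Cmod; simpl. pose proof (sin2_cos2 t) as E. unfold Rsqr in E.
    replace (cos t * cos t + sin t * sin t)%R with 1%R by lra. apply sqrt_1. }
  destruct (locally_bounded_bounded (- PI) PI
    (fun t M => forall g, isinv (e - cis t *: y) g -> (N g <= M)%R)) as [M HM].
  - pose proof PI_RGT_0; lra.
  - intros x M M' H HM g Hg. specialize (H g Hg); lra.
  - intros t _. destruct (Hinv (cis t) (Hc t)) as [h Hh].
    pose proof (norm_nonneg B h) as Nh. pose proof (norm_nonneg B y) as Ny.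
    (* Chosen so that [eta * N y * N h <= 1/2]; then half of [N g] is absorbed. The 1 guards against
       a zero denominator. *)
    set (eta := (/ (2 * (N y * N h + 1)))%R).
    assert (Hy : (0 <= N y * N h)%R) by nra.
    assert (Heta : (eta * (N y * N h + 1) = / 2)%R) by (unfold eta; field; lra).
    assert (Hp : (0 < eta)%R) by (apply Rinv_0_lt_compat; lra).
    destruct (cis_continuous t eta Hp) as [d [Hd H]].
    exists d, (2 * N h)%R. split; [exact Hd|]. intros s _ Hs g Hg.
    specialize (H s Hs).
    pose proof (resolvent_norm y g h _ _ Hg Hh) as E.
    pose proof (norm_nonneg B g) as Ng.
    pose proof (norm_triangle B (g - h) h) as F.
    replace (g - h + h) with g in F by alg.
    assert (Cmod (Csub (cis s) (cis t)) * (N y * N h) <= / 2)%R.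
    { pose proof (Cmod_nonneg (Csub (cis s) (cis t))). nra. }
    assert (N (g - h) <= N g * / 2)%R.
    { eapply Rle_trans; [exact E|].
      replace (Cmod (Csub (cis s) (cis t)) * N g * N y * N h)%R
        with (N g * (Cmod (Csub (cis s) (cis t)) * (N y * N h)))%R by ring.
      now apply Rmult_le_compat_l. }
    lra.
  - exists (Rmax M 0). split; [apply Rmax_r|]. intros z g Hz Hg.
    destruct (circle_cis z Hz) as [t [Ht ->]].
    eapply Rle_trans; [apply (HM t Ht g Hg)|apply Rmax_l].
Qed.

Lemma isinv_sub_sq (v g h : B) : isinv (e - v) g -> isinv (e + v) h ->
  isinv (e - v * v) (RtoC (/ 2) *: (g + h)).
Proof.
  intros [Hg1 Hg2] [Hh1 Hh2]. split.
  - transitivity (RtoC (/ 2) *: ((e + v) * ((e - v) * g) + (e - v) * ((e + v) * h))); [alg|].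
    rewrite Hg1, Hh1. alg_pre; repeat split; cx; field.
  - transitivity (RtoC (/ 2) *: ((g * (e - v)) * (e + v) + (h * (e + v)) * (e - v))); [alg|].
    rewrite Hg2, Hh2. alg_pre; repeat split; cx; field.
Qed.

(** Uniformity over the whole circle is what lets the property pass to [u * u]: the claim at [w]
    uses both square roots of [w]. *)
Definition radial_close (eps t : R) (u : B) : Prop :=
  forall z, Cmod z = 1%R -> exists g h,
    isinv (e - Cmul (RtoC t) z *: u) g /\ isinv (e - z *: u) h /\ (N (g - h) <= eps)%R.

(* (e - z^2 u^2)^-1 is the mean of (e - z u)^-1 and (e + z u)^-1. *)
Lemma radial_close_sq (eps t : R) (u : B) :
  radial_close eps t u -> radial_close eps (t * t) (u * u).
Proof.
  intros H w Hw. destruct (Csqrt_ex w) as [z Hz].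
  assert (Mz : Cmod z = 1%R).
  { rewrite <- Hz, Cmod_mul in Hw. pose proof (Cmod_nonneg z). nra. }
  destruct (H z Mz) as [g1 [h1 [Hg1 [Hh1 H1]]]].
  destruct (H (Copp z)) as [g2 [h2 [Hg2 [Hh2 H2]]]]; [now rewrite Cmod_Copp|].
  exists (RtoC (/ 2) *: (g1 + g2)), (RtoC (/ 2) *: (h1 + h2)). split; [|split].
  - replace (Cmul (RtoC (t * t)) w *: (u * u))
      with ((Cmul (RtoC t) z *: u) * (Cmul (RtoC t) z *: u)) by (rewrite <- Hz; alg).
    apply isinv_sub_sq; [exact Hg1|].
    replace (e + Cmul (RtoC t) z *: u) with (e - Cmul (RtoC t) (Copp z) *: u) by alg.
    exact Hg2.
  - replace (w *: (u * u)) with ((z *: u) * (z *: u)) by (rewrite <- Hz; alg).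
    apply isinv_sub_sq; [exact Hh1|].
    replace (e + z *: u) with (e - Copp z *: u) by alg. exact Hh2.
  - replace (RtoC (/ 2) *: (g1 + g2) - RtoC (/ 2) *: (h1 + h2))
      with (RtoC (/ 2) *: ((g1 - h1) + (g2 - h2))) by alg.
    rewrite norm_scal, Cmod_RtoC, Rabs_pos_eq by lra.
    pose proof (norm_triangle B (g1 - h1) (g2 - h2)). lra.
Qed.

Lemma radial_close_pow (eps t : R) (u : B) (m : nat) :
  radial_close eps t u -> radial_close eps (t ^ (2 ^ m)) (mpow u (2 ^ m)).
Proof.
  intros H. induction m as [|m IH].
  - simpl. now rewrite Rmult_1_r, mul_e_r.
  - apply radial_close_sq in IH. rewrite <- mpow_add, <- pow_add in IH.
    replace (2 ^ S m)%nat with (2 ^ m + 2 ^ m)%nat by (simpl; lia). exact IH.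
Qed.

(** From [u = (h - e) - u (h - e)] follows [N u <= eps + N u / 4]. *)
Lemma isinv_close_e (u h : B) (eps : R) : (0 <= eps <= / 4)%R ->
  isinv (e - u) h -> (N (h - e) <= eps)%R -> (N u <= 2 * eps)%R.
Proof.
  intros Heps [H _] Hh.
  assert (E : u = (h - e) - u * (h - e)).
  { transitivity ((e - u) * h - e + u); [rewrite H; alg|alg]. }
  pose proof (norm_sub B (h - e) (u * (h - e))) as F. rewrite <- E in F.
  pose proof (norm_mul B u (h - e)). pose proof (norm_nonneg B u).
  assert (N u * N (h - e) <= N u * / 4)%R by (apply Rmult_le_compat_l; lra). lra.
Qed.

(** From [g - e = u (g - e) + u e], the first term being absorbed. The factor [N e] appears because
    the unit may have norm other than 1. *)
Lemma isinv_of_small_norm (u g : B) (eps : R) : (0 <= eps)%R -> (N u <= / 2)%R ->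
  (N u * N e * 2 <= eps)%R -> isinv (e - u) g -> (N (g - e) <= eps)%R.
Proof.
  intros Heps Hu Hue [H _].
  assert (E : g - e = u * (g - e) + u * e).
  { transitivity ((e - u) * g - e + u * g); [alg|rewrite H; alg]. }
  pose proof (norm_triangle B (u * (g - e)) (u * e)) as F. rewrite <- E in F.
  pose proof (norm_mul B u (g - e)). pose proof (norm_mul B u e).
  pose proof (norm_nonneg B (g - e)).
  assert (N u * N (g - e) <= / 2 * N (g - e))%R by (apply Rmult_le_compat_r; lra). lra.
Qed.

(* Rickart's argument: averaging over roots of unity transports the uniform closeness of
   (e - s z y)^-1 and (e - z y)^-1 to the powers y^(2^m); the former tends to e. *)
Lemma small_of_radial (y : B) :
  (forall z, Cmod z = 1%R -> Inv (e - z *: y)) ->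
  (forall s, (0 <= s < 1)%R -> small (RtoC s *: y)) -> small y.
Proof.
  intros Hinv Hs. destruct (inverse_bounded_on_circle y Hinv) as [M [HM Hbd]].
  pose proof (norm_nonneg B y) as Ny.
  set (K := (N y * M)%R). assert (HK : (0 <= K)%R) by (unfold K; nra).
  (* Makes [eta * K] and [eta * K * M] at most 1/16. The closeness below then reads
     [N (g - h) <= (N (g - h) + 1) / 16], whence the 1/8 in [Hclose]. *)
  set (eta := (/ (16 * (K + 1) * (M + 1)))%R).
  assert (Heta : (eta * (K + 1) * (M + 1) = / 16)%R) by (unfold eta; field; lra).
  assert (Hp : (0 < eta)%R) by (apply Rinv_0_lt_compat; nra).
  assert (Hp1 : (eta * K <= / 16)%R).
  { assert (0 <= eta * (K + 1) * M)%R by (apply Rmult_le_pos; nra). nra. }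
  assert (Hp2 : (eta * K * M <= / 16)%R).
  { assert (0 <= eta * K)%R by nra. assert (0 <= eta * M)%R by nra. nra. }
  assert (Heta1 : (eta < 1)%R).
  { assert (0 <= eta * (K + M + K * M))%R by (apply Rmult_le_pos; nra). nra. }
  set (s := (1 - eta)%R).
  assert (Hclose : radial_close (/ 8) s y).
  { intros z Hz. destruct (Hinv z Hz) as [h Hh].
    assert (Hg : Inv (e - Cmul (RtoC s) z *: y)).
    { apply neumann. rewrite (Cx_ext (Cmul (RtoC s) z) (Cmul z (RtoC s))) by (simpl; ring).
      rewrite scal_mul. apply small_scal; [lra|]. apply Hs. unfold s; lra. }
    destruct Hg as [g Hg]. exists g, h. split; [exact Hg|]. split; [exact Hh|].
    pose proof (resolvent_norm y g h _ _ Hg Hh) as E.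
    assert (Ec : Cmod (Csub (Cmul (RtoC s) z) z) = eta).
    { replace (Csub (Cmul (RtoC s) z) z) with (Cmul (RtoC (- eta)) z)
        by (unfold s, Csub; cx; ring).
      rewrite Cmod_mul, Hz, Cmod_RtoC, Rabs_Ropp, Rabs_pos_eq; lra. }
    rewrite Ec in E. specialize (Hbd z h Hz Hh).
    pose proof (norm_nonneg B g) as Ng. pose proof (norm_nonneg B h) as Nh.
    assert (Hgh : (N (g - h) <= eta * K * N g)%R).
    { eapply Rle_trans; [exact E|]. unfold K.
      replace (eta * (N y * M) * N g)%R with (eta * N g * N y * M)%R by ring.
      apply Rmult_le_compat_l; [|exact Hbd]. repeat apply Rmult_le_pos; lra. }
    pose proof (norm_triangle B (g - h) h) as F.
    replace (g - h + h) with g in F by alg.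
    assert (0 <= eta * K)%R by nra.
    assert (eta * K * N g <= eta * K * (N (g - h) + M))%R by (apply Rmult_le_compat_l; lra).
    pose proof (norm_nonneg B (g - h)).
    assert (eta * K * N (g - h) <= / 16 * N (g - h))%R by (apply Rmult_le_compat_r; lra).
    lra. }
  pose proof (norm_nonneg B e) as Ne.
  destruct (small_pow_lt (RtoC s *: y) (/ (16 * (N e + 1)))) as [n Hn].
  { apply Hs; unfold s; lra. }
  { apply Rinv_0_lt_compat; lra. }
  assert (Hm : (n <= 2 ^ n)%nat) by (apply Nat.lt_le_incl, Nat.pow_gt_lin_r; lia).
  specialize (Hn (2 ^ n)%nat Hm). set (p := (2 ^ n)%nat) in *.
  pose proof (radial_close_pow _ _ _ n Hclose) as Hr. fold p in Hr.
  destruct (Hr Cone Cmod_Cone) as [g [h [Hg [Hh Hgh]]]].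
  rewrite norm_mpow_scal, Cmod_RtoC, Rabs_pos_eq in Hn by (unfold s; lra).
  rewrite scal_one in Hh.
  set (q := Cmul (RtoC (s ^ p)) Cone *: mpow y p) in *.
  assert (Hq : N q = (s ^ p * N (mpow y p))%R).
  { unfold q. rewrite norm_scal, Cmod_mul, Cmod_Cone, Cmod_RtoC, Rabs_pos_eq.
    - ring.
    - apply pow_le; unfold s; lra. }
  rewrite <- Hq in Hn.
  assert (Hqe : (N q * (16 * (N e + 1)) <= 1)%R).
  { apply (Rmult_lt_compat_r (16 * (N e + 1))) in Hn; [|lra].
    rewrite Rinv_l in Hn by lra. lra. }
  pose proof (norm_nonneg B q).
  assert (0 <= N q * N e)%R by nra.
  (* [g] is within 1/8 of [e] and [h] within 1/8 of [g], so [h] is within 1/4 of [e], which forces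
     [N (mpow y p) <= 1/2]. *)
  assert (Hge : (N (g - e) <= / 8)%R) by (apply (isinv_of_small_norm q); [lra|nra|nra|exact Hg]).
  assert (Hhe : (N (h - e) <= / 4)%R).
  { replace (h - e) with ((g - e) - (g - h)) by alg.
    pose proof (norm_sub B (g - e) (g - h)). lra. }
  pose proof (isinv_close_e _ _ (/ 4) ltac:(lra) Hh Hhe) as Hu.
  assert (Hp0 : p = S (p - 1)).
  { assert (p <> 0)%nat by (apply Nat.pow_nonzero; lia). lia. }
  apply (small_of_pow_lt1 y (p - 1)). rewrite <- Hp0. lra.
Qed.

(** Let [t] be the supremum of the scalings in [[0, 1]] that make [y] small. [small_of_radial] shows
    that it is attained, and [small_open] that it is not below 1. *)
Theorem small_of_resolvent (y : B) :
  (forall z, (Cmod z <= 1)%R -> Inv (e - z *: y)) -> small y.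
Proof.
  intros Hinv.
  set (S := fun t => (0 <= t <= 1)%R /\ small (RtoC t *: y)).
  pose proof (norm_nonneg B y) as Ny.
  set (t0 := (/ (2 * (N y + 1)))%R).
  assert (Et0 : (t0 * (N y + 1) = / 2)%R) by (unfold t0; field; lra).
  assert (Ht0 : (0 < t0)%R) by (apply Rinv_0_lt_compat; lra).
  assert (S0 : S t0).
  { split; [nra|]. apply small_of_norm. rewrite norm_scal, Cmod_RtoC, Rabs_pos_eq by lra. nra. }
  destruct (completeness S) as [t [Ht1 Ht2]].
  { exists 1%R. intros x [Hx _]; lra. }
  { exists t0; exact S0. }
  assert (Ht : (t0 <= t)%R) by now apply Ht1.
  assert (Htb : (t <= 1)%R) by (apply Ht2; intros x [Hx _]; lra).
  assert (Hsub : forall r r', (0 <= r <= r')%R -> (0 < r')%R -> small (RtoC r' *: y) ->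
    small (RtoC r *: y)).
  { intros r r' Hr Hr' H. replace (RtoC r *: y) with (RtoC (r / r') *: (RtoC r' *: y)).
    - apply small_scal; [|exact H]. rewrite Cmod_RtoC, Rabs_pos_eq.
      + apply Rmult_le_reg_r with r'; [exact Hr'|]. field_simplify; lra.
      + apply Rmult_le_pos; [lra|left; now apply Rinv_0_lt_compat].
    - rewrite <- scal_mul. f_equal. cx; field; lra. }
  assert (Hst : small (RtoC t *: y)).
  { apply small_of_radial.
    - intros z Hz. rewrite <- scal_mul. apply Hinv.
      rewrite Cmod_mul, Hz, Cmod_RtoC, Rabs_pos_eq; lra.
    - intros s Hs. rewrite <- scal_mul.
      replace (Cmul (RtoC s) (RtoC t)) with (RtoC (s * t)) by (cx; ring).
      assert (Hr : exists r, S r /\ (s * t < r)%R).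
      { apply NNPP. intros Hn. assert (t <= s * t)%R; [|nra].
        apply Ht2. intros r Hr. apply Rnot_lt_le. intros Hlt. apply Hn. now exists r. }
      destruct Hr as [r [[Hr Hsm] Hlt]]. apply (Hsub _ r); [nra|nra|exact Hsm]. }
  destruct (Rle_lt_or_eq_dec t 1 Htb) as [Hlt|Heq].
  - exfalso. destruct (small_open _ Hst) as [c [Hc Hsm]].
    rewrite <- scal_mul in Hsm.
    replace (Cmul (RtoC c) (RtoC t)) with (RtoC (c * t)) in Hsm by (cx; ring).
    assert (Hmin : (t < Rmin 1 (c * t))%R) by (apply Rmin_glb_lt; nra).
    assert (Hmin' : (Rmin 1 (c * t) <= c * t)%R) by apply Rmin_r.
    assert (Hm1 : (Rmin 1 (c * t) <= 1)%R) by apply Rmin_l.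
    assert (HS : S (Rmin 1 (c * t))).
    { split; [lra|]. apply (Hsub _ (c * t)%R); [lra|nra|exact Hsm]. }
    apply Ht1 in HS. lra.
  - rewrite Heq in Hst. fold Cone in Hst. now rewrite scal_one in Hst.
Qed.

(** * Square roots *)

Section Dominated.
Variables (h : B) (C rho : R).
Hypotheses (HC : (0 <= C)%R) (Hrho : (0 < rho < 1)%R).
Hypothesis Hh : forall n, (N (mpow h n) <= C * rho ^ n)%R.

(* Left multiplication by y has norm at most s for the seminorm sup_n |h^n z| / rho^n. *)
Definition dominated (y : B) (s : R) : Prop :=
  forall z c, (0 <= c)%R -> (forall n, (N (mpow h n * z) <= c * rho ^ n)%R) ->
  forall n, (N (mpow h n * (y * z)) <= s * c * rho ^ n)%R.

Lemma rho_pow_nonneg n : (0 <= rho ^ n)%R.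
Proof. apply pow_le; lra. Qed.

Lemma dominated_zero : dominated 0 0.
Proof.
  intros z c _ _ n. replace (mpow h n * (0 * z)) with (0 : B) by alg. rewrite norm_zero; lra.
Qed.

Lemma dominated_self : dominated h rho.
Proof.
  intros z c Hc H n. rewrite mul_assoc, <- mpow_S_r. eapply Rle_trans; [apply (H (S n))|].
  simpl; lra.
Qed.

Lemma dominated_e : dominated e 1.
Proof. intros z c Hc H n. rewrite mul_e_l, Rmult_1_l. apply H. Qed.

Lemma dominated_add y1 y2 s1 s2 :
  dominated y1 s1 -> dominated y2 s2 -> dominated (y1 + y2) (s1 + s2).
Proof.
  intros H1 H2 z c Hc H n. specialize (H1 z c Hc H n). specialize (H2 z c Hc H n).
  rewrite mul_addl, mul_addr. eapply Rle_trans; [apply norm_triangle|]. lra.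
Qed.

Lemma dominated_scal a y s : dominated y s -> dominated (a *: y) (Cmod a * s).
Proof.
  intros H1 z c Hc H n. specialize (H1 z c Hc H n).
  rewrite <- scal_mull, <- scal_mulr, norm_scal, !Rmult_assoc.
  apply Rmult_le_compat_l; [apply Cmod_nonneg|lra].
Qed.

Lemma dominated_mul y1 y2 s1 s2 : (0 <= s2)%R ->
  dominated y1 s1 -> dominated y2 s2 -> dominated (y1 * y2) (s1 * s2).
Proof.
  intros Hs H1 H2 z c Hc H n. rewrite <- mul_assoc, (Rmult_assoc s1).
  apply H1; [nra|]. intros m. now apply H2.
Qed.

Lemma dominated_weaken y s s' : (s <= s')%R -> dominated y s -> dominated y s'.
Proof.
  intros Hs H1 z c Hc H n. specialize (H1 z c Hc H n). eapply Rle_trans; [exact H1|].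
  apply Rmult_le_compat_r; [apply rho_pow_nonneg|]. now apply Rmult_le_compat_r.
Qed.

(** Evaluate at [z = e], whose seminorm is at most [C] by [Hh], and at [n = 0]. *)
Lemma dominated_norm y s : dominated y s -> (N y <= s * C)%R.
Proof.
  intros H. specialize (H e C HC). simpl in H.
  assert (G : forall n, (N (mpow h n * e) <= C * rho ^ n)%R) by (intros; rewrite mul_e_r; apply Hh).
  specialize (H G 0%nat). simpl in H. rewrite mul_e_r, mul_e_l in H. lra.
Qed.

Lemma dominated_pow y s k : (0 <= s)%R -> dominated y s -> dominated (mpow y k) (s ^ k).
Proof.
  intros Hs H. induction k as [|k IH]; [apply dominated_e|].
  apply dominated_mul; [now apply pow_le|assumption|assumption].
Qed.

Lemma dominated_limit (y : nat -> B) (l : B) (s K q : R) : (0 <= q < 1)%R ->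
  (forall n, (N (y n - l) <= K * q ^ n)%R) -> (forall n, dominated (y n) s) -> dominated l s.
Proof.
  intros Hq Hl Hy z c Hc H n. apply Rminus_le.
  apply (geom_le_0 (N (mpow h n) * (K * N z)) q); [exact Hq|]. intros m.
  specialize (Hy m z c Hc H n). specialize (Hl m).
  replace (mpow h n * (l * z)) with (mpow h n * (y m * z) - mpow h n * ((y m - l) * z)) by alg.
  pose proof (norm_sub B (mpow h n * (y m * z)) (mpow h n * ((y m - l) * z))).
  pose proof (norm_mul B (mpow h n) ((y m - l) * z)).
  pose proof (norm_mul B (y m - l) z).
  pose proof (norm_nonneg B (mpow h n)). pose proof (norm_nonneg B z).
  assert (N (y m - l) * N z <= K * q ^ m * N z)%R by now apply Rmult_le_compat_r.
  assert (N (mpow h n) * N ((y m - l) * z) <= N (mpow h n) * (K * q ^ m * N z))%R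
    by (apply Rmult_le_compat_l; lra). lra.
Qed.

(* The contraction x |-> (h + x^2) / 2, with rate sigma = 1 - sqrt (1 - rho), computes
   1 - sqrt (1 - h). *)
Lemma quadratic_fixpoint : exists x, small x /\ x + x = h + x * x /\
  forall z, z * h = h * z -> z * x = x * z.
Proof.
  set (sg := (1 - sqrt (1 - rho))%R).
  assert (Hsq : (sqrt (1 - rho) * sqrt (1 - rho) = 1 - rho)%R) by (apply sqrt_sqrt; lra).
  assert (Hq : (0 < sqrt (1 - rho))%R) by (apply sqrt_lt_R0; lra).
  assert (Hsg : (0 < sg < 1)%R) by (unfold sg; split; nra).
  (* The scalar form of the same fixed-point equation, so the bound [sg] on the iterates reproduces
     itself. *)
  assert (Esg : (/ 2 * (rho + sg * sg) = sg)%R) by (unfold sg; nra).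
  assert (Hex : exists x : nat -> B, x 0%nat = 0 /\
    forall n, x (S n) = RtoC (/ 2) *: (h + x n * x n)).
  { exists (fix x n := match n with O => 0 | S n' => RtoC (/ 2) *: (h + x n' * x n') end).
    split; reflexivity. }
  destruct Hex as [x [Hx0 HxS]].
  assert (Hhalf : forall y s, dominated y s -> dominated (RtoC (/ 2) *: y) (/ 2 * s)).
  { intros y s Hy. apply (dominated_scal (RtoC (/ 2))) in Hy.
    rewrite Cmod_RtoC, Rabs_pos_eq in Hy by lra. exact Hy. }
  assert (Hcom : forall n z, z * h = h * z -> z * x n = x n * z).
  { intros n z Hz. induction n as [|n IH]; [rewrite Hx0; alg|]. rewrite HxS.
    transitivity (RtoC (/ 2) *: (z * h + (z * x n) * x n)); [alg|].
    rewrite Hz, IH. transitivity (RtoC (/ 2) *: (h * z + x n * (z * x n))); [alg|].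
    rewrite IH. alg. }
  assert (Hhx : forall n, h * x n = x n * h) by (intros; now apply Hcom).
  assert (Hdom : forall n, dominated (x n) sg).
  { intros n; induction n as [|n IH].
    - rewrite Hx0. apply (dominated_weaken _ 0); [lra|apply dominated_zero].
    - rewrite HxS, <- Esg. apply Hhalf, dominated_add; [apply dominated_self|].
      apply dominated_mul; [lra|exact IH|exact IH]. }
  (* As the iterates commute, a difference is half the previous difference times a sum of two
     iterates, a factor of [(sg + sg) / 2]. *)
  assert (Hdiff : forall n, dominated (x (S n) - x n) (sg ^ n)).
  { intros n; induction n as [|n IH].
    - simpl. rewrite HxS, Hx0. replace (RtoC (/ 2) *: (h + 0 * 0) - 0) with (RtoC (/ 2) *: h) by alg.
      apply (dominated_weaken _ (/ 2 * rho)); [lra|].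
      apply Hhalf, dominated_self.
    - replace (x (S (S n)) - x (S n))
        with (RtoC (/ 2) *: ((x (S n) - x n) * (x (S n) + x n))).
      + replace (sg ^ S n)%R with (/ 2 * (sg ^ n * (sg + sg)))%R
          by (simpl; field).
        apply Hhalf, dominated_mul; [lra|exact IH|apply dominated_add; apply Hdom].
      + transitivity (RtoC (/ 2) *: (x (S n) * x (S n) - x n * x n)).
        * transitivity (RtoC (/ 2) *: (x (S n) * x (S n) - x n * x n
              + (x (S n) * x n - x n * x (S n)))); [alg|].
          rewrite (Hcom (S n) (x n) (eq_sym (Hhx n))). alg.
        * rewrite (HxS (S n)), (HxS n) at 1. rewrite (HxS n) at 1.
          rewrite (HxS n). alg. }
  destruct (geometric_limit x C sg) as [l Hl]; [lra| |].
  { intros n. pose proof (dominated_norm _ _ (Hdiff n)). lra. }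
  set (K := (C / (1 - sg))%R) in *.
  assert (Hn : forall n, (0 <= sg ^ n)%R) by (intros; apply pow_le; lra).
  assert (HK : (0 <= K)%R).
  { apply Rmult_le_pos; [lra|]. left; apply Rinv_0_lt_compat; lra. }
  exists l. split; [|split].
  - assert (D : dominated l sg) by (apply (dominated_limit x l sg K sg); [lra|exact Hl|exact Hdom]).
    exists C, sg. split; [exact HC|]. split; [exact Hsg|]. intros n.
    rewrite Rmult_comm. apply dominated_norm, dominated_pow; [lra|exact D].
  - apply sub_eq0.
    apply (eq0_of_geom _ (2 * K * sg + K * (sg * C) + N l * K) sg); [lra|]. intros n.
    (* The residual of the limit in terms of the errors at [n] and [S n]. *)
    replace (l + l - (h + l * l))
      with ((x n - l) * x n + l * (x n - l) - RtoC 2 *: (x (S n) - l)).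
    2:{ rewrite HxS. alg_pre; repeat split; cx; field. }
    pose proof (Hl n) as L1. pose proof (Hl (S n)) as L2. simpl in L2.
    pose proof (dominated_norm _ _ (Hdom n)) as Nx.
    eapply Rle_trans; [apply norm_sub|]. rewrite norm_scal, Cmod_RtoC, Rabs_pos_eq by lra.
    pose proof (norm_triangle B ((x n - l) * x n) (l * (x n - l))).
    pose proof (norm_mul B (x n - l) (x n)). pose proof (norm_mul B l (x n - l)).
    pose proof (norm_nonneg B l). pose proof (norm_nonneg B (x n)).
    pose proof (norm_nonneg B (x n - l)).
    assert (N (x n - l) * N (x n) <= K * sg ^ n * (sg * C))%R by now apply Rmult_le_compat.
    assert (N l * N (x n - l) <= N l * (K * sg ^ n))%R by now apply Rmult_le_compat_l.
    lra.
  - intros z Hz. apply sub_eq0. apply (eq0_of_geom _ (2 * N z * K) sg); [lra|]. intros n.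
    replace (z * l - l * z) with ((x n - l) * z - z * (x n - l)).
    2:{ transitivity (z * l - l * z + (x n * z - z * x n)); [alg|].
        rewrite (Hcom n z Hz). alg. }
    eapply Rle_trans; [apply norm_sub|].
    pose proof (norm_mul B (x n - l) z). pose proof (norm_mul B z (x n - l)).
    pose proof (norm_nonneg B z). specialize (Hl n).
    assert (N z * N (x n - l) <= N z * (K * sg ^ n))%R by now apply Rmult_le_compat_l. lra.
Qed.

End Dominated.

(** A discontinuous involution gives no control of the norms of the powers, but it preserves
    invertibility; hence the route through the resolvent. *)
Lemma small_star (x : B) : small x -> small (x^*).
Proof.
  intros H. apply small_of_resolvent. intros z Hz.
  replace (e - z *: x^*) with ((e - Cconj z *: x)^*).
  - apply Inv_star, neumann, small_scal; [now rewrite Cmod_Cconj|exact H].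
  - rewrite star_sub, star_e, star_scal. alg.
Qed.

Lemma small_half_sum (x y : B) : x * y = y * x -> small x -> small y ->
  small (RtoC (/ 2) *: (x + y)).
Proof.
  intros Hxy [C1 [r1 [HC1 [Hr1 H1]]]] [C2 [r2 [HC2 [Hr2 H2]]]].
  set (r := Rmax r1 r2).
  assert (Hr : (0 < r < 1)%R) by (split; [apply Rlt_le_trans with (2 := Rmax_l r1 r2); lra
                                         |apply Rmax_lub_lt; lra]).
  assert (L : forall C q m, (0 <= C)%R -> (0 < q <= r)%R -> (C * q ^ m <= C * r ^ m)%R).
  { intros C q m HC Hq. apply Rmult_le_compat_l; [exact HC|]. apply pow_incr; lra. }
  assert (P : forall m, (0 <= r ^ m)%R) by (intros; apply pow_le; lra).
  (* The binomial expansion without binomial coefficients: each factor [x + y] doubles the number of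
     terms, all of total degree [n + i + j]. The [2 ^ n] is cancelled by the scalar 1/2. *)
  assert (K : forall n i j, (N (mpow (x + y) n * (mpow x i * mpow y j))
    <= C1 * C2 * 2 ^ n * r ^ (n + i + j))%R).
  { intros n; induction n as [|n IH]; intros i j.
    - simpl. rewrite mul_e_l. eapply Rle_trans; [apply norm_mul|].
      rewrite pow_add. replace (C1 * C2 * 1 * (r ^ i * r ^ j))%R
        with ((C1 * r ^ i) * (C2 * r ^ j))%R by ring.
      apply Rmult_le_compat; try apply norm_nonneg.
      + eapply Rle_trans; [apply H1|apply L; [exact HC1|split; [lra|apply Rmax_l]]].
      + eapply Rle_trans; [apply H2|apply L; [exact HC2|split; [lra|apply Rmax_r]]].
    - replace (mpow (x + y) (S n) * (mpow x i * mpow y j))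
        with (mpow (x + y) n * (mpow x (S i) * mpow y j)
              + mpow (x + y) n * (mpow x i * mpow y (S j))).
      + eapply Rle_trans; [apply norm_triangle|].
        pose proof (IH (S i) j) as G1. pose proof (IH i (S j)) as G2.
        replace (S n + i + j)%nat with (n + S i + j)%nat by lia.
        replace (n + i + S j)%nat with (n + S i + j)%nat in G2 by lia.
        replace (2 ^ S n)%R with (2 * 2 ^ n)%R by (simpl; ring). lra.
      + rewrite (mpow_S_r (x + y)). simpl mpow.
        transitivity (mpow (x + y) n * (x * mpow x i * mpow y j)
          + mpow (x + y) n * ((mpow x i * y) * mpow y j)); [alg|].
        rewrite <- (mpow_commute x y i (eq_sym Hxy)). alg. }
  exists (C1 * C2)%R, r. split; [nra|]. split; [exact Hr|]. intros n.
  rewrite norm_mpow_scal, Cmod_RtoC, Rabs_pos_eq by lra.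
  specialize (K n 0%nat 0%nat). simpl in K. rewrite !mul_e_r, !Nat.add_0_r in K.
  assert (E : ((/ 2) ^ n * 2 ^ n = 1)%R).
  { rewrite <- Rpow_mult_distr, <- (pow1 n). f_equal. field. }
  assert (0 <= (/ 2) ^ n)%R by (apply pow_le; lra).
  apply Rle_trans with ((/ 2) ^ n * (C1 * C2 * 2 ^ n * r ^ n))%R; [now apply Rmult_le_compat_l|].
  right. transitivity ((/ 2) ^ n * 2 ^ n * (C1 * C2 * r ^ n))%R; [ring|]. rewrite E; ring.
Qed.

(** Half the difference of the two equations is [(x - y) (e - (x + y) / 2)], and the second factor
    is invertible. *)
Lemma small_fixpoint_unique (x y h : B) : x * y = y * x -> small x -> small y ->
  x + x = h + x * x -> y + y = h + y * y -> x = y.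
Proof.
  intros Hxy Hx Hy Ex Ey.
  destruct (neumann _ (small_half_sum x y Hxy Hx Hy)) as [g [Hg _]].
  apply sub_eq0. rewrite <- (mul_e_r (x - y)), <- Hg.
  transitivity (RtoC (/ 2) *: ((x + x - x * x - (y + y - y * y)) + (y * x - x * y)) * g).
  - alg_pre; repeat split; cx; field.
  - rewrite Ex, Ey, Hxy. alg.
Qed.

(* The involution need not be continuous: the root is self-adjoint because its adjoint solves
   the same equation. *)
Lemma ford_square_root (h : B) : h^* = h -> small h ->
  exists w, w^* = w /\ Inv w /\ w * w = e - h.
Proof.
  intros Hs Hsm. pose proof Hsm as [C [rho [HC [Hr H]]]].
  destruct (quadratic_fixpoint h C rho HC Hr H) as [x [Hx [Ex Cx]]].
  assert (Es : x^* + x^* = h + x^* * x^*).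
  { rewrite <- star_add, Ex, star_add, star_mul, Hs. reflexivity. }
  (* Needed so that [x^*] commutes with [x], which commutes with whatever commutes with [h]. *)
  assert (Ch : x^* * h = h * x^*).
  { rewrite <- Hs at 1. rewrite <- star_mul, (Cx h eq_refl), star_mul, Hs. reflexivity. }
  assert (Hxx : x^* = x).
  { apply (small_fixpoint_unique (x^*) x h); [now apply Cx|now apply small_star|exact Hx| |];
      assumption. }
  exists (e - x). split; [|split].
  - now rewrite star_sub, star_e, Hxx.
  - now apply neumann.
  - transitivity (e - (x + x) + x * x); [alg|]. rewrite Ex. alg.
Qed.

(** * Positivity in Hermitian algebras *)

Definition real_spectra : Prop :=
  forall b : B, b^* = b -> forall z, Im z <> 0%R -> Inv (z *: e - b).

Section Hermitian.
Hypothesis HH : real_spectra.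

(** Multiplied by [-i], the element becomes [-i e - i s] with [i s] self-adjoint. *)
Lemma skew_Inv (s : B) : s^* = - s -> Inv (e + s).
Proof.
  intros Hs. apply (Inv_scal_inv (Copp Ci)).
  { intros E; apply (f_equal Im) in E; simpl in E; lra. }
  replace (Copp Ci *: (e + s)) with (Copp Ci *: e - Ci *: s) by alg.
  apply HH; [|simpl; lra]. rewrite star_scal, Hs. alg.
Qed.

Lemma small_skew_Inv (h k : B) : h^* = h -> small h -> k^* = - k -> Inv (e - h + k).
Proof.
  intros Hh Hsm Hk. destruct (ford_square_root h Hh Hsm) as [w [Hw [[v Hv] Ew]]].
  assert (Hvs : v^* = v).
  { apply (isinv_unique w); [|exact Hv]. rewrite <- Hw. now apply isinv_star. }
  assert (Hi : Inv (e + v * k * v)).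
  { apply skew_Inv. rewrite !star_mul, Hvs, Hk. alg. }
  pose proof Hv as [H1 H2].
  replace (e - h + k) with (w * (e + v * k * v) * w).
  - apply Inv_mul; [apply Inv_mul; [|exact Hi]|]; now exists v.
  - transitivity (w * w + (w * v) * k * (v * w)); [alg|]. rewrite H1, H2, Ew. alg.
Qed.

(** Multiplying [e - a] by [e + a^*] on the left or right gives [e - a^* a] or [e - a a^*], plus the
    skew element [a^* - a]. Both products are invertible, which yields a left and a right
    inverse. *)
Lemma sub_Inv_of_small_star_mul (a : B) : small (a^* * a) -> Inv (e - a).
Proof.
  intros H. assert (Hk : (a^* - a)^* = - (a^* - a)) by (rewrite star_sub, star_star; alg).
  destruct (small_skew_Inv (a^* * a) (a^* - a)) as [g [_ Hg]];
    [now rewrite star_mul, star_star|exact H|exact Hk|].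
  destruct (small_skew_Inv (a * a^*) (a^* - a)) as [g' [Hg' _]];
    [now rewrite star_mul, star_star|now apply small_comm|exact Hk|].
  apply (Inv_of_left_right _ (g * (e + a^*)) ((e + a^*) * g')).
  - etransitivity; [|exact Hg]. alg.
  - etransitivity; [|exact Hg']. alg.
Qed.

(** For [a = z x y] the product [a^* a] is a multiple of [y x^2 y], a cyclic rearrangement of
    [x^2 y^2]. *)
Lemma small_mul_step (x y : B) : x^* = x -> y^* = y -> small ((x * x) * (y * y)) ->
  small (x * y).
Proof.
  intros Hx Hy H. apply small_of_resolvent. intros z Hz.
  apply sub_Inv_of_small_star_mul. rewrite star_scal, star_mul, Hx, Hy.
  replace (Cconj z *: (y * x) * (z *: (x * y))) with (Cmul (Cconj z) z *: (y * ((x * x) * y)))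
    by alg.
  apply small_scal.
  - rewrite Cmod_mul, Cmod_Cconj. pose proof (Cmod_nonneg z). nra.
  - apply small_comm. rewrite <- mul_assoc. exact H.
Qed.

(** Descend by repeated halving from the exponent [2^(n+m)], which exceeds both thresholds, so that
    both powers have norm below 1. *)
Lemma small_mul (u v : B) : u^* = u -> v^* = v -> small u -> small v -> small (u * v).
Proof.
  intros Hu Hv Su Sv.
  assert (K : forall n, small (mpow u (2 ^ n) * mpow v (2 ^ n)) -> small (u * v)).
  { intros n; induction n as [|n IH]; intros H.
    - simpl in H. now rewrite !mul_e_r in H.
    - apply IH, small_mul_step; [now rewrite <- mpow_star, Hu|now rewrite <- mpow_star, Hv|].
      rewrite <- !mpow_add. replace (2 ^ n + 2 ^ n)%nat with (2 ^ S n)%nat by (simpl; lia).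
      exact H. }
  destruct (small_pow_lt u 1 Su ltac:(lra)) as [n Hn].
  destruct (small_pow_lt v 1 Sv ltac:(lra)) as [m Hm].
  assert (G : (n + m < 2 ^ (n + m))%nat) by (apply Nat.pow_gt_lin_r; lia).
  apply (K (n + m)%nat), small_of_norm. eapply Rle_lt_trans; [apply norm_mul|].
  specialize (Hn (2 ^ (n + m))%nat ltac:(lia)). specialize (Hm (2 ^ (n + m))%nat ltac:(lia)).
  pose proof (norm_nonneg B (mpow u (2 ^ (n + m)))).
  pose proof (norm_nonneg B (mpow v (2 ^ (n + m)))). nra.
Qed.

(** Only negative reals are kept out of the spectrum here; [HH] excludes the non-real points. *)
Definition positive (h : B) : Prop :=
  h^* = h /\ forall t, (0 < t)%R -> Inv (RtoC t *: e + h).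

Lemma positive_scal (t : R) (h : B) : (0 < t)%R -> positive h -> positive (RtoC t *: h).
Proof.
  intros Ht [Hs H]. split.
  - rewrite star_scal, Hs. f_equal. cx; ring.
  - intros s Hst.
    replace (RtoC s *: e + RtoC t *: h) with (RtoC t *: (RtoC (s / t) *: e + h))
      by (alg_pre; repeat split; cx; field; lra).
    apply Inv_scal; [intros E; apply (f_equal Re) in E; simpl in E; lra|].
    apply H. now apply Rdiv_lt_0_compat.
Qed.

(** The function [x / (1 + x)] maps the nonnegative reals into [[0, 1)]. Concretely
    [e - z h p = (e + c h) p] with [c = 1 - z], and [Re c >= 0] prevents [-1/c] from being a
    positive real, so that [1/c] is either positive or not real. *)
Lemma positive_resolvent_small (h p : B) : positive h -> isinv (e + h) p ->
  (h * p)^* = h * p /\ small (h * p).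
Proof.
  intros [Hs H] Hp.
  assert (Hps : p^* = p).
  { apply (isinv_unique (e + h)); [|exact Hp].
    replace (e + h) with ((e + h)^*) by now rewrite star_add, star_e, Hs.
    now apply isinv_star. }
  assert (Hc : h * p = p * h) by (apply (isinv_commute (e + h)); [exact Hp|alg]).
  split; [now rewrite star_mul, Hps, Hs|].
  apply small_of_resolvent. intros z Hz.
  set (c := Csub Cone z).
  replace (e - z *: (h * p)) with ((e + c *: h) * p).
  2:{ transitivity ((e + h) * p - z *: (h * p)); [unfold c, Csub; alg|].
      destruct Hp as [-> _]. reflexivity. }
  apply Inv_mul; [|exists (e + h); now apply isinv_sym].
  destruct (classic (c = Czero)) as [->|Hc0].
  { replace (e + Czero *: h) with e by alg. apply Inv_e. }
  assert (Hi : Cinv c <> Czero).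
  { intros E. pose proof (Cmul_Cinv c Hc0) as F. rewrite E in F.
    apply (f_equal Re) in F; simpl in F; lra. }
  apply (Inv_scal_inv (Cinv c)); [exact Hi|].
  replace (Cinv c *: (e + c *: h)) with (Cinv c *: e + h).
  2:{ transitivity (Cinv c *: e + Cmul c (Cinv c) *: h); [|alg].
      now rewrite (Cmul_Cinv c Hc0), scal_one. }
  pose proof (Cx_neq0_sq c Hc0) as Hd.
  destruct (Req_dec (Im c) 0) as [Ei|Ei].
  - replace (Cinv c) with (RtoC (/ Re c)).
    2:{ unfold Cinv; rewrite Ei in Hd |- *; cx; field; nra. }
    apply H. apply Rinv_0_lt_compat.
    assert (Re c <> 0)%R by (intros E; rewrite E, Ei in Hd; lra).
    pose proof (Re_le_Cmod z) as L. pose proof (Rle_abs (Re z)).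
    unfold c in *; simpl in *. lra.
  - replace (Cinv c *: e + h) with (- (Copp (Cinv c) *: e - h)) by alg.
    apply Inv_opp, HH; [exact Hs|]. clearbody c. unfold Cinv; simpl.
    set (d := (Re c * Re c + Im c * Im c)%R) in *. intros E. apply Ei.
    replace (Im c) with (- (- Im c / d) * d)%R by (field; lra). rewrite E; ring.
Qed.

Lemma positive_add (h k : B) : positive h -> positive k -> positive (h + k).
Proof.
  (* The case [t = 1]; scaling by [/ t] gives the others. *)
  assert (K : forall h k : B, positive h -> positive k -> Inv (e + h + k)).
  { clear h k. intros h k Hh Hk.
    assert (I : forall h : B, positive h -> Inv (e + h)).
    { intros x [_ Hx]. specialize (Hx 1%R ltac:(lra)). fold Cone in Hx.
      now rewrite scal_one in Hx. }
    destruct (I h Hh) as [p Hp]. destruct (I k Hk) as [q Hq].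
    destruct (positive_resolvent_small h p Hh Hp) as [Hu Su].
    destruct (positive_resolvent_small k q Hk Hq) as [Hv Sv].
    assert (Hc : h * p = p * h) by (apply (isinv_commute (e + h)); [exact Hp|alg]).
    replace (e + h + k) with ((e + h) * (e - (h * p) * (k * q)) * (e + k)).
    - apply Inv_mul; [apply Inv_mul; [now exists p|]|now exists q].
      apply neumann. now apply small_mul.
    - rewrite Hc.
      transitivity ((e + h) * (e + k) - ((e + h) * p) * h * k * (q * (e + k))); [alg|].
      destruct Hp as [-> _]. destruct Hq as [_ ->]. alg. }
  intros Hh Hk. split.
  - rewrite star_add. destruct Hh as [-> _], Hk as [-> _]. reflexivity.
  - intros t Ht. assert (Ht' : (0 < / t)%R) by now apply Rinv_0_lt_compat.
    replace (RtoC t *: e + (h + k)) with (RtoC t *: (e + RtoC (/ t) *: h + RtoC (/ t) *: k))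
      by (alg_pre; repeat split; cx; field; lra).
    apply Inv_scal; [intros E; apply (f_equal Re) in E; simpl in E; lra|].
    apply K; now apply positive_scal.
Qed.

(** [t e + b^2] factors as [(z e - b) (- z e - b)] with [z] equal to [i sqrt t]. *)
Lemma positive_sq (b : B) : b^* = b -> positive (b * b).
Proof.
  intros Hb. split; [now rewrite star_mul, Hb|]. intros t Ht.
  assert (Hq : (0 < sqrt t)%R) by now apply sqrt_lt_R0.
  assert (Es : (sqrt t * sqrt t = t)%R) by (apply sqrt_sqrt; lra).
  set (z := mkC 0 (sqrt t)).
  replace (RtoC t *: e + b * b) with ((z *: e - b) * (Copp z *: e - b)).
  - apply Inv_mul; apply HH; try exact Hb; unfold z; simpl; lra.
  - rewrite <- Es. unfold z. alg.
Qed.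

(** Jacobson's lemma: the inverse is [e + y g x]. *)
Lemma Inv_e_sub_comm (x y : B) : Inv (e - x * y) -> Inv (e - y * x).
Proof.
  intros [g [H1 H2]]. exists (e + y * g * x). split.
  - transitivity (e - y * x + y * ((e - x * y) * g) * x); [alg|]. rewrite H1. alg.
  - transitivity (e - y * x + y * (g * (e - x * y)) * x); [alg|]. rewrite H2. alg.
Qed.

Lemma Inv_resolvent_comm (z : Cx) (x y : B) : z <> Czero ->
  Inv (z *: e - x * y) -> Inv (z *: e - y * x).
Proof.
  intros Hz H. pose proof (Cmul_Cinv z Hz) as E.
  assert (K : forall u v : B, z *: e - u * v = z *: (e - (Cinv z *: u) * v)).
  { intros u v. transitivity (z *: e - Cmul z (Cinv z) *: (u * v)).
    - now rewrite E, scal_one.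
    - alg. }
  rewrite K in H |- *. apply Inv_scal; [exact Hz|]. apply Inv_scal_inv in H; [|exact Hz].
  apply Inv_e_sub_comm. replace (x * (Cinv z *: y)) with (Cinv z *: x * y) by alg. exact H.
Qed.

(* a a* = 2 (h^2 + k^2) - a* a for a = h + i k. *)
Lemma star_mul_spectrum_lower (a : B) (r : R) : (0 <= r)%R ->
  (forall t, (r < t)%R -> Inv (RtoC t *: e - a^* * a)) ->
  forall t, (t < - r)%R -> Inv (RtoC t *: e - a^* * a).
Proof.
  intros Hr H t Ht. apply Inv_resolvent_comm.
  { intros E; apply (f_equal Re) in E; simpl in E; lra. }
  set (h := RtoC (/ 2) *: (a + a^*)).
  set (k := mkC 0 (- / 2) *: (a - a^*)).
  (* The midpoint of [r] and [- t]. Adding [2 (h^2 + k^2)] to [s e - a^* a] gives [s e + a a^*], and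
     [- t - s > 0] remains for the definition of positivity. *)
  set (s := ((r - t) / 2)%R).
  assert (Hs : (r < s < - t)%R) by (unfold s; lra).
  assert (Ph : positive (h * h)).
  { apply positive_sq. unfold h. rewrite star_scal, star_add, star_star. alg. }
  assert (Pk : positive (k * k)).
  { apply positive_sq. unfold k. rewrite star_scal, star_sub, star_star. alg. }
  assert (Pa : positive (RtoC s *: e - a^* * a)).
  { split.
    - rewrite star_sub, star_scal, star_e, star_mul, star_star. alg.
    - intros q Hq. replace (RtoC q *: e + (RtoC s *: e - a^* * a))
        with (RtoC (q + s) *: e - a^* * a) by alg.
      apply H; lra. }
  pose proof (positive_add _ _ (positive_add _ _ (positive_add _ _ Ph Ph)
    (positive_add _ _ Pk Pk)) Pa) as [_ P].
  specialize (P (- t - s)%R ltac:(lra)). apply Inv_opp in P.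
  match type of P with Inv ?x => replace x with (RtoC t *: e - a * a^*) in P; [exact P|] end.
  unfold h, k. alg_pre; repeat split; cx; field.
Qed.

End Hermitian.

End Unital.

Arguments Inv {B} e x.
Arguments small {B} e x.
Arguments mpow {B} e x n.

(** * The functionals of the statement *)

Lemma pow_lt_compat (a b : R) (n : nat) : 0 <= a < b -> a ^ S n < b ^ S n.
Proof.
  intros H. induction n as [|n IH]; [simpl; lra|].
  change (a * a ^ S n < b * b ^ S n).
  apply Rmult_le_0_lt_compat; try lra. apply pow_le; lra.
Qed.

Lemma nroot_nonneg (x : R) (n : nat) : 0 <= nroot x n.
Proof.
  unfold nroot. destruct (Rle_dec x 0); [lra|]. left; apply exp_pos.
Qed.

Lemma nroot_pow (x : R) (n : nat) : 0 <= x -> nroot x (S n) ^ S n = x.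
Proof.
  intros Hx. unfold nroot. destruct (Rle_dec x 0).
  - replace x with 0 by lra. simpl. ring.
  - rewrite <- Rpower_pow by apply exp_pos. rewrite Rpower_mult, Rinv_l, Rpower_1; [reflexivity|lra|].
    apply not_0_INR; discriminate.
Qed.

(** The infimum exists as minus the supremum of the negated set, so the choice operator does return
    it. *)
Lemma r_lambda_is_inf (A : BanachStarAlgebra) (a : A) :
  is_inf (fun x => exists k : nat, x = nroot (norm A (pw A a k)) (S k)) (r_lambda A a).
Proof.
  unfold r_lambda. apply epsilon_spec.
  set (E := fun x => exists k : nat, x = nroot (norm A (pw A a k)) (S k)).
  destruct (completeness (fun y => E (- y))) as [m [H1 H2]].
  - exists 0. intros y [k Hk]. pose proof (nroot_nonneg (norm A (pw A a k)) (S k)). lra.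
  - exists (- nroot (norm A (pw A a 0)) 1). exists 0%nat. ring.
  - exists (- m). split.
    + intros x Hx. assert (- x <= m) by (apply H1; now rewrite Ropp_involutive). lra.
    + intros b Hb. assert (m <= - b); [|lra]. apply H2. intros y Hy. specialize (Hb _ Hy). lra.
Qed.

Lemma r_lambda_nonneg (A : BanachStarAlgebra) (a : A) : 0 <= r_lambda A a.
Proof.
  apply (r_lambda_is_inf A a). intros x [k ->]. apply nroot_nonneg.
Qed.

Lemma r_sigma_le1 (A : BanachStarAlgebra) (a : A) :
  r_sigma A a <= 1 <-> r_lambda A (mul A (star A a) a) <= 1.
Proof.
  unfold r_sigma. pose proof (r_lambda_nonneg A (mul A (star A a) a)) as H.
  split; intros H'.
  - rewrite <- (sqrt_sqrt _ H). pose proof (sqrt_pos (r_lambda A (mul A (star A a) a))). nra.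
  - rewrite <- sqrt_1. now apply sqrt_le_1_alt.
Qed.

(** * Transfer along an embedding into a unital algebra, covering both [A] itself and its
    unitisation *)

Section Embedding.
Variables (A B : BanachStarAlgebra) (e : B) (j : A -> B).
Hypothesis He : is_unit B e.
Hypothesis j_add : forall x y, j (add A x y) = add B (j x) (j y).
Hypothesis j_scal : forall c x, j (scal A c x) = scal B c (j x).
Hypothesis j_mul : forall x y, j (mul A x y) = mul B (j x) (j y).
Hypothesis j_star : forall x, j (star A x) = star B (j x).
Hypothesis j_norm : forall x, norm B (j x) = norm A x.
Hypothesis j_inv : forall l x, inv_At A l x <-> Inv e (add B (scal B l e) (j x)).
Hypothesis j_herm : forall b, star B b = b ->
  exists l x, star A x = x /\ b = add B (scal B (RtoC l) e) (j x).

Local Notation "x + y" := (add B x y) : alg_scope.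
Local Notation "x * y" := (mul B x y) : alg_scope.
Local Notation "- x" := (opp B x) : alg_scope.
Local Notation "x - y" := (sub B x y) : alg_scope.
Local Notation "c *: x" := (scal B c x) (at level 40) : alg_scope.
Local Notation "x ^*" := (star B x) (at level 2, format "x ^*") : alg_scope.
Local Notation N := (norm B).
Local Open Scope alg_scope.

Lemma j_opp x : j (opp A x) = - j x.
Proof. rewrite !opp_scal. apply j_scal. Qed.

Lemma j_sub x y : j (sub A x y) = j x - j y.
Proof. unfold sub. now rewrite j_add, j_opp. Qed.

Lemma sp_iff (a : A) (z : Cx) : sp A a z <-> ~ Inv e (z *: e - j a).
Proof. unfold sp. rewrite j_inv, j_opp. reflexivity. Qed.

Lemma not_sp_Inv (a : A) (z : Cx) : ~ sp A a z -> Inv e (z *: e - j a).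
Proof. rewrite sp_iff. apply NNPP. Qed.

Lemma j_pw (a : A) (k : nat) : j (pw A a k) = mpow e (j a) (S k).
Proof.
  induction k as [|k IH]; [simpl; symmetry; apply (mul_e_r B e He)|].
  change (j (mul A a (pw A a k)) = j a * mpow e (j a) (S k)). now rewrite j_mul, IH.
Qed.

Lemma small_of_r_lambda (a : A) (t : R) : (0 < t)%R -> (r_lambda A a < t)%R ->
  small e (RtoC (/ t) *: j a).
Proof.
  intros Ht H. destruct (r_lambda_is_inf A a) as [_ Hinf].
  assert (Hk : exists k, (nroot (norm A (pw A a k)) (S k) < t)%R).
  { apply NNPP. intros Hn. assert (t <= r_lambda A a)%R; [|lra].
    apply Hinf. intros x [k ->]. apply Rnot_lt_le. intros Hlt. apply Hn. now exists k. }
  destruct Hk as [k Hk].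
  pose proof (pow_lt_compat _ _ k (conj (nroot_nonneg _ _) Hk)) as L.
  rewrite nroot_pow in L by apply norm_nonneg.
  apply (small_of_pow_lt1 B e He _ k).
  rewrite norm_mpow_scal, <- j_pw, j_norm, Cmod_RtoC, Rabs_pos_eq.
  - rewrite pow_inv. assert (0 < t ^ S k)%R by now apply pow_lt.
    apply (Rmult_lt_reg_l (t ^ S k)); [assumption|].
    rewrite <- Rmult_assoc, Rinv_r by lra. lra.
  - left; now apply Rinv_0_lt_compat.
Qed.

Lemma r_lambda_of_small (a : A) (t : R) : (0 < t)%R -> small e (RtoC (/ t) *: j a) ->
  (r_lambda A a <= t)%R.
Proof.
  intros Ht H. destruct (small_pow_lt B e _ 1%R H ltac:(lra)) as [n Hn].
  specialize (Hn (S n) ltac:(lia)).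
  rewrite norm_mpow_scal, <- j_pw, j_norm, Cmod_RtoC, Rabs_pos_eq in Hn
    by (left; now apply Rinv_0_lt_compat).
  rewrite pow_inv in Hn. assert (P : (0 < t ^ S n)%R) by now apply pow_lt.
  apply (Rmult_lt_compat_l (t ^ S n)) in Hn; [|exact P].
  rewrite <- Rmult_assoc, Rinv_r in Hn by lra.
  apply Rle_trans with (nroot (norm A (pw A a n)) (S n)).
  - apply (proj1 (r_lambda_is_inf A a)). now exists n.
  - apply Rnot_lt_le. intros L.
    pose proof (pow_lt_compat t _ n (conj (Rlt_le _ _ Ht) L)) as L'.
    rewrite nroot_pow in L' by apply norm_nonneg. lra.
Qed.

Lemma r_lambda_le_norm (a : A) : (r_lambda A a <= norm A a)%R.
Proof.
  apply le_epsilon. intros eps Heps. pose proof (norm_nonneg A a).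
  apply r_lambda_of_small; [lra|]. apply (small_of_norm B e He).
  rewrite norm_scal, j_norm, Cmod_RtoC, Rabs_pos_eq by (left; apply Rinv_0_lt_compat; lra).
  apply (Rmult_lt_reg_l (norm A a + eps)%R); [lra|].
  rewrite <- Rmult_assoc, Rinv_r by lra. lra.
Qed.

(** If the bound failed, [a / |z|] would be small; so would its product with the unimodular
    [|z| / z], and the Neumann series would invert [z e - a]. *)
Lemma sp_bound (a : A) (z : Cx) : sp A a z -> (Cmod z <= r_lambda A a)%R.
Proof.
  rewrite sp_iff. intros H. apply Rnot_lt_le. intros L. apply H. clear H.
  pose proof (r_lambda_nonneg A a) as P.
  assert (Hz : z <> Czero) by (intros ->; rewrite Cmod_Czero in L; lra).
  pose proof (small_of_r_lambda a (Cmod z) ltac:(lra) L) as S.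
  replace (z *: e - j a) with (z *: (e - Cmul (Cinv z) (RtoC (Cmod z)) *: (RtoC (/ Cmod z) *: j a))).
  - apply (Inv_scal B e); [exact Hz|]. apply (neumann B e He), (small_scal B e); [|exact S].
    rewrite Cmod_mul, Cmod_Cinv, Cmod_RtoC, Rabs_pos_eq by (assumption || lra).
    rewrite Rinv_l; lra.
  - transitivity (z *: e - Cmul (Cmul z (Cinv z)) (Cmul (RtoC (Cmod z)) (RtoC (/ Cmod z))) *: j a);
      [alg|].
    rewrite Cmul_Cinv by exact Hz.
    replace (Cmul (RtoC (Cmod z)) (RtoC (/ Cmod z))) with Cone by (cx; field; lra). alg.
Qed.

(** For [t > r] and [0 < |z| <= 1], the element [e - z a / t] is a multiple of [(t/z) e - a], and
    [|t/z| > r]. *)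
Lemma r_lambda_le_of_sp (a : A) (r : R) : (0 <= r)%R ->
  (forall z, sp A a z -> (Cmod z <= r)%R) -> (r_lambda A a <= r)%R.
Proof.
  intros Hr H. apply le_epsilon. intros eps Heps. set (t := (r + eps)%R).
  assert (Ht : (r < t)%R) by (unfold t; lra).
  apply r_lambda_of_small; [lra|]. apply (small_of_resolvent B e He). intros z Hz.
  destruct (classic (z = Czero)) as [->|Hz0].
  { replace (e - Czero *: (RtoC (/ t) *: j a)) with e by alg. apply (Inv_e B e He). }
  assert (Hzt : Cmul z (RtoC (/ t)) <> Czero).
  { intros E. apply (f_equal Cmod) in E.
    rewrite Cmod_mul, Cmod_RtoC, Cmod_Czero, Rabs_pos_eq in E
      by (left; apply Rinv_0_lt_compat; lra).
    apply Rmult_integral in E as [E|E]; [now apply Cmod_eq0 in E|].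
    assert (0 < / t)%R by (apply Rinv_0_lt_compat; lra). lra. }
  set (w := Cmul (RtoC t) (Cinv z)).
  replace (e - z *: (RtoC (/ t) *: j a)) with (Cmul z (RtoC (/ t)) *: (w *: e - j a)).
  - apply (Inv_scal B e); [exact Hzt|]. apply not_sp_Inv. intros S. apply H in S.
    unfold w in S. rewrite Cmod_mul, Cmod_Cinv, Cmod_RtoC, Rabs_pos_eq in S by (assumption || lra).
    assert (Hp : (0 < Cmod z)%R).
    { destruct (Cmod_nonneg z) as [|E]; [assumption|]. now symmetry in E; apply Cmod_eq0 in E. }
    apply (Rmult_le_compat_r (Cmod z)) in S; [|lra].
    rewrite Rmult_assoc, Rinv_l in S by lra. nra.
  - unfold w. transitivity (Cmul (Cmul z (Cinv z)) (Cmul (RtoC t) (RtoC (/ t))) *: e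
      - z *: (RtoC (/ t) *: j a)); [alg|].
    rewrite Cmul_Cinv by exact Hz0.
    replace (Cmul (RtoC t) (RtoC (/ t))) with Cone by (cx; field; lra). alg.
Qed.

(** The spectral radius is an upper bound and 0 a member, so the supremum exists for the choice
    operator. *)
Lemma max_nonneg_sp_is_lub (a : A) :
  is_lub (fun t => (0 <= t /\ sp A a (RtoC t)) \/ t = 0)%R (max_nonneg_sp A a).
Proof.
  unfold max_nonneg_sp. apply epsilon_spec.
  destruct (completeness (fun t => (0 <= t /\ sp A a (RtoC t)) \/ t = 0)%R) as [m Hm].
  - exists (r_lambda A a). intros t [[Ht S]| ->]; [|apply r_lambda_nonneg].
    apply sp_bound in S. now rewrite Cmod_RtoC, Rabs_pos_eq in S.
  - exists 0%R. now right.
  - now exists m.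
Qed.

Lemma hermitian_real_spectra : hermitian A -> real_spectra B e.
Proof.
  intros H b Hb z Hz. destruct (j_herm b Hb) as [l [x [Hx ->]]].
  replace (z *: e - (RtoC l *: e + j x)) with (Csub z (RtoC l) *: e - j x)
    by (unfold Csub; alg).
  apply not_sp_Inv. intros S. apply (H x Hx) in S. simpl in S. lra.
Qed.

Lemma hermitian_symmetric_interval : hermitian A -> forall (a : A) z,
  let lam := max_nonneg_sp A (mul A (star A a) a) in
  sp A (mul A (star A a) a) z -> (Im z = 0 /\ - lam <= Re z <= lam)%R.
Proof.
  intros H a z lam Hz.
  assert (E : Im z = 0%R) by (apply (H (mul A (star A a) a)); [now rewrite star_mul, star_star|exact Hz]).
  destruct (max_nonneg_sp_is_lub (mul A (star A a) a)) as [Hub _]. fold lam in Hub.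
  assert (Hlam : (0 <= lam)%R) by (apply Hub; now right).
  replace z with (RtoC (Re z)) in Hz by (cx; lra).
  split; [exact E|]. split.
  - apply Rnot_lt_le. intros L. rewrite sp_iff in Hz. apply Hz.
    rewrite j_mul, j_star.
    apply (star_mul_spectrum_lower B e He (hermitian_real_spectra H) (j a) lam Hlam); [|exact L].
    intros t Ht. rewrite <- j_star, <- j_mul. apply not_sp_Inv. intros S.
    assert (t <= lam)%R by (apply Hub; left; split; [lra|exact S]). lra.
  - destruct (Rle_or_lt 0 (Re z)); [|lra]. apply Hub. left. now split.
Qed.

(** * The cubic polynomial behind the map in statement (iii) *)

Lemma real_cubic_roots (al t : R) : (2 <= al)%R -> (1 < t)%R ->
  let be := (al + 1)%R in
  exists z0 z1 z2,
    Cadd z0 (Cadd z1 z2) = RtoC (2 * be) /\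
    Cadd (Cmul z0 (Cadd z1 z2)) (Cmul z1 z2) = RtoC (be * be) /\
    Cmul z0 (Cmul z1 z2) = RtoC (al * al * t).
Proof.
  intros Hal Ht be.
  set (f := fun x => (x * ((be - x) * (be - x)) - al * al * t)%R).
  assert (Hat : (0 < al * al * t)%R) by (apply Rmult_lt_0_compat; nra).
  (* A real root [x] of [x (be - x)^2 = al^2 t]; the quadratic formula then gives the other two. The
     roots are recorded by their elementary symmetric functions. *)
  destruct (IVT f 0 (be + (al * al * t + 1))) as [x [_ Hx]].
  - unfold f. reg.
  - unfold be; lra.
  - unfold f. lra.
  - unfold f. set (s := (al * al * t + 1)%R). assert (Hs : (1 < s)%R) by (unfold s; lra).
    replace (be - (be + s))%R with (- s)%R by ring.
    assert (Hb : (3 <= be)%R) by (unfold be; lra).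
    assert (al * al * t = s - 1)%R by (unfold s; ring).
    assert (s <= s * s)%R by nra. nra.
  - unfold f in Hx. set (s := (2 * be - x)%R). set (p := (be * be - x * s)%R).
    destruct (Csqrt_ex (RtoC (s * s - 4 * p))) as [d Hd].
    exists (RtoC x), (Cmul (RtoC (/ 2)) (Cadd (RtoC s) d)),
      (Cmul (RtoC (/ 2)) (Csub (RtoC s) d)).
    assert (Ep : Cmul (Cmul (RtoC (/ 2)) (Cadd (RtoC s) d)) (Cmul (RtoC (/ 2)) (Csub (RtoC s) d))
      = RtoC p).
    { transitivity (Cmul (RtoC (/ 4)) (Csub (RtoC (s * s)) (Cmul d d))).
      - unfold Csub; cx; field.
      - rewrite Hd. unfold Csub; cx; field. }
    rewrite Ep. split; [|split]; unfold Csub; cx; unfold p, s in *; try field; try lra.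
Qed.

Lemma cubic_root_not_real (al t : R) (z0 z1 z2 : Cx) : (2 <= al)%R -> (1 < t)%R ->
  let be := (al + 1)%R in
  Cadd z0 (Cadd z1 z2) = RtoC (2 * be) ->
  Cadd (Cmul z0 (Cadd z1 z2)) (Cmul z1 z2) = RtoC (be * be) ->
  Cmul z0 (Cmul z1 z2) = RtoC (al * al * t) ->
  Im z0 = 0%R -> ~ (-1 <= Re z0 <= 1)%R.
Proof.
  intros Hal Ht be E1 E2 E3 Hi Hr.
  (* The symmetric functions turn back into the cubic equation for [z0]. *)
  assert (E : Cmul z0 (Cmul (Csub (RtoC be) z0) (Csub (RtoC be) z0)) = RtoC (al * al * t)).
  { rewrite <- E3.
    transitivity (Csub (Cmul z0 (RtoC (be * be)))
      (Csub (Cmul (Cmul z0 z0) (RtoC (2 * be))) (Cmul z0 (Cmul z0 z0)))).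
    - unfold Csub; cx; ring.
    - rewrite <- E1, <- E2. unfold Csub; cx; ring. }
  apply (f_equal Re) in E. simpl in E. rewrite Hi in E. set (r := Re z0) in *.
  assert (Er : (r * ((be - r) * (be - r)) = al * al * t)%R) by (rewrite <- E; ring).
  destruct (Rle_or_lt r 0).
  - assert (0 < al * al * t)%R by (apply Rmult_lt_0_compat; nra).
    assert (0 <= (be - r) * (be - r))%R by apply Rle_0_sqr.
    apply (Rmult_le_compat_r ((be - r) * (be - r))) in H; lra.
  (* This factorisation shows that the cubic stays at most [al^2] on [[0, 1]]; here [al >= 2]
     enters. *)
  - assert (Ef : (al * al - r * ((be - r) * (be - r))
      = (1 - r) * ((1 - r) * (2 * al - r) + al * (al - 2)))%R) by (unfold be; ring).
    assert (0 <= (1 - r) * (2 * al - r))%R by (apply Rmult_le_pos; lra).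
    assert (0 <= al * (al - 2))%R by (apply Rmult_le_pos; lra).
    assert (0 <= (1 - r) * ((1 - r) * (2 * al - r) + al * (al - 2)))%R
      by (apply Rmult_le_pos; lra).
    assert (al * al < al * al * t)%R by nra. lra.
Qed.

Section Iteration.
Variables (alpha : R).
Hypothesis Halpha : (2 <= alpha)%R.
Local Notation beta := (alpha + 1)%R.

Definition cstep (a : A) : A :=
  scal A (RtoC (/ alpha)) (sub A (scal A (RtoC beta) a) (mul A (mul A a (star A a)) a)).

(** The polynomial [x (beta - x)^2 / alpha^2], expanded and evaluated at [h]. *)
Definition cubic (h : B) : B :=
  RtoC (/ (alpha * alpha)) *:
    (RtoC (beta * beta) *: h - RtoC (2 * beta) *: (h * h) + h * (h * h)).

Lemma j_cstep (a : A) : j (mul A (star A (cstep a)) (cstep a)) = cubic (j (mul A (star A a) a)).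
Proof.
  unfold cstep, cubic.
  rewrite star_scal, star_sub, star_scal, !star_mul, star_star.
  repeat rewrite ?j_mul, ?j_scal, ?j_sub, ?j_star.
  alg_pre; repeat split; cx; field; lra.
Qed.

(** Up to a scalar, the resolvent is the product of the three [z_i e - h], and no root [z_i] lies in
    [[-1, 1]]. *)
Lemma cubic_resolvent (h : B) (t : R) : (1 < t)%R ->
  (forall z, ~ (Im z = 0 /\ -1 <= Re z <= 1)%R -> Inv e (z *: e - h)) ->
  Inv e (RtoC t *: e - cubic h).
Proof.
  intros Ht H. destruct (real_cubic_roots alpha t Halpha Ht) as [z0 [z1 [z2 [E1 [E2 E3]]]]].
  assert (K : forall w0 w1 w2, Cadd w0 (Cadd w1 w2) = RtoC (2 * beta) ->
    Cadd (Cmul w0 (Cadd w1 w2)) (Cmul w1 w2) = RtoC (beta * beta) ->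
    Cmul w0 (Cmul w1 w2) = RtoC (alpha * alpha * t) -> Inv e (w0 *: e - h)).
  { intros w0 w1 w2 F1 F2 F3. apply H. intros [Hi Hr].
    exact (cubic_root_not_real alpha t w0 w1 w2 Halpha Ht F1 F2 F3 Hi Hr). }
  assert (Ha : (0 < alpha * alpha)%R) by nra.
  assert (E : RtoC t *: e - cubic h
    = RtoC (/ (alpha * alpha)) *: ((z0 *: e - h) * (z1 *: e - h) * (z2 *: e - h))).
  { transitivity (RtoC (/ (alpha * alpha)) *: (RtoC (alpha * alpha * t) *: e
      - RtoC (beta * beta) *: h + RtoC (2 * beta) *: (h * h) - h * (h * h))).
    - unfold cubic. alg_pre; repeat split; cx; field; lra.
    - rewrite <- E1, <- E2, <- E3. alg. }
  rewrite E. apply (Inv_scal B e).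
  { intros F. apply (f_equal Re) in F. simpl in F.
    assert (0 < / (alpha * alpha))%R by now apply Rinv_0_lt_compat. lra. }
  apply (Inv_mul B e He); [apply (Inv_mul B e He)|].
  - now apply (K z0 z1 z2).
  - apply (K z1 z0 z2); [rewrite <- E1|rewrite <- E2|rewrite <- E3]; cx; ring.
  - apply (K z2 z0 z1); [rewrite <- E1|rewrite <- E2|rewrite <- E3]; cx; ring.
Qed.

(** The hypothesis is used twice: for [a], to make the spectrum of [h] real, and for [cstep a],
    where it reduces the claim to an upper bound on the nonnegative spectrum. *)
Lemma interval_r_sigma_stable :
  (forall (a : A) z, let lam := max_nonneg_sp A (mul A (star A a) a) in
     sp A (mul A (star A a) a) z -> (Im z = 0 /\ - lam <= Re z <= lam)%R) ->
  forall a : A, (r_sigma A a <= 1)%R -> (r_sigma A (cstep a) <= 1)%R.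
Proof.
  intros H a Ha. apply r_sigma_le1 in Ha. apply r_sigma_le1.
  set (h := mul A (star A a) a) in *.
  set (k := mul A (star A (cstep a)) (cstep a)).
  assert (Hh : forall z, sp A h z -> (Im z = 0 /\ -1 <= Re z <= 1)%R).
  { intros z Hz. split; [now apply (H a z)|].
    apply sp_bound in Hz. pose proof (Re_le_Cmod z) as L.
    unfold Rabs in L. destruct (Rcase_abs (Re z)); lra. }
  assert (Hlam : (max_nonneg_sp A k <= 1)%R).
  { apply (proj2 (max_nonneg_sp_is_lub k)). intros t [[Ht S]| ->]; [|lra].
    apply Rnot_lt_le. intros L. apply sp_iff in S. apply S. unfold k. rewrite j_cstep.
    apply cubic_resolvent; [exact L|]. intros z Hz. apply not_sp_Inv.
    intros Sz. now apply Hz, Hh. }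
  apply r_lambda_le_of_sp; [lra|]. intros z Hz. apply H in Hz as [Hi Hr]. fold k in Hr.
  replace z with (RtoC (Re z)) by (cx; lra). rewrite Cmod_RtoC. apply Rabs_le. lra.
Qed.

Lemma sp_cstep (a : A) (s : R) : sp A (mul A (star A a) a) (RtoC (- s)) ->
  sp A (mul A (star A (cstep a)) (cstep a))
    (RtoC (- (s * ((beta + s) * (beta + s)) / (alpha * alpha)))).
Proof.
  rewrite !sp_iff, j_cstep. intros H G. apply H. set (h := j (mul A (star A a) a)) in *.
  (* The cofactor of [- s - x] in [q(- s) - q(x)], where [q(x) = x (beta - x)^2 / alpha^2]. *)
  apply (Inv_factor B e He _ (RtoC (/ (alpha * alpha)) *:
    (RtoC (beta * beta + 2 * beta * s + s * s) *: e - RtoC (2 * beta + s) *: h + h * h))).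
  - alg.
  - match type of G with Inv _ ?x =>
    match goal with |- Inv _ ?y => replace y with x; [exact G|] end end.
    unfold cubic. alg_pre; repeat split; cx; field; lra.
Qed.

Lemma sp_star_mul_scal (a : A) (d t : R) : (d <> 0)%R -> sp A (mul A (star A a) a) (RtoC t) ->
  sp A (mul A (star A (scal A (RtoC d) a)) (scal A (RtoC d) a)) (RtoC (d * d * t)).
Proof.
  intros Hd. rewrite !sp_iff. intros H G. apply H.
  apply (Inv_scal_inv B e (RtoC (d * d))).
  { intros E; apply (f_equal Re) in E; simpl in E. nra. }
  replace (RtoC (d * d) *: (RtoC t *: e - j (mul A (star A a) a)))
    with (RtoC (d * d * t) *: e - j (mul A (star A (scal A (RtoC d) a)) (scal A (RtoC d) a)));
    [exact G|].
  rewrite star_scal, !j_mul, !j_scal, j_star. alg.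
Qed.

Lemma stable_no_negative :
  (forall a : A, (r_sigma A a <= 1)%R -> (r_sigma A (cstep a) <= 1)%R) ->
  forall (a : A) (t : R), (t < 0)%R -> ~ sp A (mul A (star A a) a) (RtoC t).
Proof.
  intros H a t Ht S. set (h := mul A (star A a) a) in *.
  (* Scaling [a] by [d] brings [r_sigma] down to at most 1, as [d^2 * norm A h <= 1]. *)
  pose proof (norm_nonneg A h) as Nh. set (d := (/ (1 + norm A h))%R).
  assert (Hd : (0 < d)%R) by (apply Rinv_0_lt_compat; lra).
  assert (Ed : (d * (1 + norm A h) = 1)%R) by (apply Rinv_l; lra).
  set (s0 := (d * d * - t)%R). assert (Hs0 : (0 < s0)%R) by (unfold s0; apply Rmult_lt_0_compat; nra).
  (* Linear growth is enough: each application of [cstep] raises [s] by at least [s0 / alpha],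
     whereas [r_sigma A b <= 1] caps [s] at 1. *)
  assert (K : forall n : nat, exists (b : A) s, (r_sigma A b <= 1)%R /\
    sp A (mul A (star A b) b) (RtoC (- s)) /\ (s0 + INR n * (s0 / alpha) <= s)%R).
  { intros n; induction n as [|n [b [s [H1 [H2 H3]]]]].
    - exists (scal A (RtoC d) a), s0. split; [|split].
      + apply r_sigma_le1. eapply Rle_trans; [apply r_lambda_le_norm|].
        rewrite star_scal, <- scal_mull, <- scal_mulr, !norm_scal, Cmod_Cconj, Cmod_RtoC,
          Rabs_pos_eq by lra. fold h. nra.
      + replace (- s0)%R with (d * d * t)%R by (unfold s0; ring).
        apply sp_star_mul_scal; [lra|exact S].
      + simpl. lra.
    - exists (cstep b), (s * ((beta + s) * (beta + s)) / (alpha * alpha))%R. split; [|split].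
      + now apply H.
      + now apply sp_cstep.
      + rewrite S_INR. assert (0 <= INR n)%R by apply pos_INR.
        assert (Ha : (0 < s0 / alpha)%R) by (apply Rdiv_lt_0_compat; lra).
        assert (Hs : (s0 <= s)%R) by nra.
        assert (Eq : (s * ((beta + s) * (beta + s)) / (alpha * alpha)
          = s + s / alpha + s * ((alpha + 1) + 2 * beta * s + s * s) / (alpha * alpha))%R)
          by (field; lra).
        assert (s0 / alpha <= s / alpha)%R.
        { apply Rmult_le_compat_r; [left; apply Rinv_0_lt_compat|]; lra. }
        assert (0 <= s * ((alpha + 1) + 2 * beta * s + s * s) / (alpha * alpha))%R.
        { apply Rmult_le_pos; [nra|]. left; apply Rinv_0_lt_compat; nra. }
        lra. }
  assert (Ha : (0 < s0 / alpha)%R) by (apply Rdiv_lt_0_compat; lra).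
  destruct (INR_unbounded (/ (s0 / alpha))) as [n Hn].
  destruct (K n) as [b [s [H1 [H2 H3]]]].
  apply r_sigma_le1 in H1. apply sp_bound in H2.
  rewrite Cmod_RtoC, Rabs_Ropp in H2. pose proof (Rle_abs s).
  apply (Rmult_lt_compat_r (s0 / alpha)) in Hn; [|exact Ha]. rewrite Rinv_l in Hn by lra. lra.
Qed.

End Iteration.

Lemma no_negative_hermitian :
  (forall (a : A) (t : R), (t < 0)%R -> ~ sp A (mul A (star A a) a) (RtoC t)) -> hermitian A.
Proof.
  intros H x Hx z Hz. apply NNPP. intros Hi. rewrite sp_iff in Hz. apply Hz.
  set (a := Re z). set (b := Im z) in *.
  assert (Hd : (a * a + b * b <> 0)%R) by (assert (0 < b * b)%R by nra; nra).
  (* The real solution of [s z + t z^2 = i]. The polynomial has no constant term, so [y] below lies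
     in [A]. *)
  set (s := ((b * b - a * a) / (b * (a * a + b * b)))%R).
  set (t := (a / (b * (a * a + b * b)))%R).
  assert (Ez : Cadd (Cmul (RtoC s) z) (Cmul (RtoC t) (Cmul z z)) = Ci).
  { cx; fold a b; unfold s, t; field; auto. }
  set (y := add A (scal A (RtoC s) x) (scal A (RtoC t) (mul A x x))).
  assert (Hy : star A y = y).
  { unfold y. rewrite star_add, !star_scal, star_mul, Hx. f_equal; f_equal; cx; ring. }
  specialize (H y (-1)%R ltac:(lra)). apply not_sp_Inv in H.
  rewrite Hy, j_mul in H. set (w := j y) in *.
  assert (H1 : Inv e (Ci *: e - w)).
  { apply (Inv_factor B e He _ (Ci *: e + w)); [alg|].
    replace ((Ci *: e - w) * (Ci *: e + w)) with (RtoC (-1) *: e - w * w) by alg. exact H. }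
  (* The difference [i e - w] is [z e - j x] times this cofactor, by the choice of [s] and [t]. *)
  apply (Inv_factor B e He _ (RtoC s *: e + RtoC t *: (z *: e + j x))); [alg|].
  match type of H1 with Inv _ ?u =>
    match goal with |- Inv _ ?v => replace v with u; [exact H1|] end end.
  rewrite <- Ez. unfold w, y. rewrite j_add, !j_scal, j_mul. alg.
Qed.

Lemma no_negative_iff_inv :
  (forall (a : A) (t : R), (t < 0)%R -> ~ sp A (mul A (star A a) a) (RtoC t)) <->
  (forall a : A, inv_At A Cone (mul A (star A a) a)).
Proof.
  split; intros H a.
  - apply j_inv. specialize (H a (-1)%R ltac:(lra)). apply not_sp_Inv, (Inv_opp B e) in H.
    match type of H with Inv _ ?x => replace x with (Cone *: e + j (mul A (star A a) a)) in H;
      [exact H|alg] end.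
  - intros t Ht S.
    (* Scaling [a] by this root moves the spectral point [t] to -1. *)
    assert (Hq : (0 < sqrt (/ - t))%R) by (apply sqrt_lt_R0, Rinv_0_lt_compat; lra).
    assert (Eq : (sqrt (/ - t) * sqrt (/ - t) = / - t)%R)
      by (apply sqrt_sqrt; left; apply Rinv_0_lt_compat; lra).
    apply (sp_star_mul_scal a (sqrt (/ - t))) in S; [|lra]. rewrite Eq in S.
    replace (/ - t * t)%R with (-1)%R in S by (field; lra). apply sp_iff in S. apply S.
    specialize (H (scal A (RtoC (sqrt (/ - t))) a)). apply j_inv, (Inv_opp B e) in H.
    match type of H with Inv _ ?x =>
    match goal with |- Inv _ ?y => replace y with x; [exact H|alg] end end.
Qed.

Lemma hermitian_characterisations (alpha : R) (Halpha : (2 <= alpha)%R) :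
  let i_ := hermitian A in
  let ii_ := forall a : A,
      let lam := max_nonneg_sp A (mul A (star A a) a) in
      forall z, sp A (mul A (star A a) a) z -> (Im z = 0 /\ - lam <= Re z <= lam)%R in
  let iii_ := forall a : A, (r_sigma A a <= 1)%R -> (r_sigma A (cstep alpha a) <= 1)%R in
  let iv_ := forall (a : A) (t : R), (t < 0)%R -> ~ sp A (mul A (star A a) a) (RtoC t) in
  let v_ := forall a : A, inv_At A Cone (mul A (star A a) a) in
  (i_ <-> ii_) /\ (i_ <-> iii_) /\ (i_ <-> iv_) /\ (i_ <-> v_).
Proof.
  intros i_ ii_ iii_ iv_ v_.
  assert (H1 : i_ -> ii_) by exact hermitian_symmetric_interval.
  assert (H2 : ii_ -> iii_) by exact (interval_r_sigma_stable alpha Halpha).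
  assert (H3 : iii_ -> iv_) by exact (stable_no_negative alpha Halpha).
  assert (H4 : iv_ -> i_) by exact no_negative_hermitian.
  assert (H5 : iv_ <-> v_) by exact no_negative_iff_inv.
  tauto.
Qed.

End Embedding.

(** * The unitisation *)

Section Unitisation.
Variable A : BanachStarAlgebra.

Lemma Cx_complete (u : nat -> Cx) :
  (forall eps, eps > 0 -> exists n0, forall m n, (m >= n0)%nat -> (n >= n0)%nat ->
     Cmod (Csub (u m) (u n)) < eps) ->
  exists l, forall eps, eps > 0 -> exists n0, forall n, (n >= n0)%nat ->
     Cmod (Csub (u n) l) < eps.
Proof.
  intros H.
  destruct (R_complete (fun n => Re (u n))) as [x Hx].
  { intros eps Heps. destruct (H eps Heps) as [n0 Hn0]. exists n0. intros n m Hn Hm.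
    eapply Rle_lt_trans; [apply (Re_le_Cmod (Csub (u n) (u m)))|now apply Hn0]. }
  destruct (R_complete (fun n => Im (u n))) as [y Hy].
  { intros eps Heps. destruct (H eps Heps) as [n0 Hn0]. exists n0. intros n m Hn Hm.
    eapply Rle_lt_trans; [apply (Im_le_Cmod (Csub (u n) (u m)))|now apply Hn0]. }
  exists (mkC x y). intros eps Heps.
  destruct (Hx (eps / 2) ltac:(lra)) as [n1 Hn1].
  destruct (Hy (eps / 2) ltac:(lra)) as [n2 Hn2].
  exists (n1 + n2)%nat. intros n Hn.
  specialize (Hn1 n ltac:(lia)). specialize (Hn2 n ltac:(lia)).
  eapply Rle_lt_trans; [apply Cmod_le_add|].
  change (Rabs (Re (u n) - x) + Rabs (Im (u n) - y) < eps). unfold Rdist in *. lra.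
Qed.

(** Closed transparently, so that its operations reduce to components. *)
Definition unitisation : BanachStarAlgebra.
Proof.
  unshelve refine {|
    car := (Cx * A)%type;
    zero := (Czero, zero A);
    add := fun p q => (Cadd (fst p) (fst q), add A (snd p) (snd q));
    opp := fun p => (Copp (fst p), opp A (snd p));
    scal := fun c p => (Cmul c (fst p), scal A c (snd p));
    mul := umul A;
    star := fun p => (Cconj (fst p), star A (snd p));
    norm := fun p => Cmod (fst p) + norm A (snd p) |}.
  (* The purely algebraic axioms, checked in each component. *)
  1-17: intros; repeat match goal with p : prod _ _ |- _ => destruct p end;
    unfold umul; cbn [fst snd]; rewrite ?star_add, ?star_scal, ?star_mul, ?star_star;
    apply (f_equal2 pair); [cx; ring|alg].
  - intros [l x]; cbn [fst snd]. pose proof (Cmod_nonneg l). pose proof (norm_nonneg A x). lra.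
  - intros [l x]; cbn [fst snd]. intros H.
    pose proof (Cmod_nonneg l). pose proof (norm_nonneg A x). f_equal.
    + apply Cmod_eq0; lra.
    + apply norm_eq0; lra.
  - intros [l x] [m y]; cbn [fst snd].
    pose proof (Cmod_add l m). pose proof (norm_triangle A x y). lra.
  - intros c [l x]; cbn [fst snd]. rewrite Cmod_mul, norm_scal. ring.
  - intros [l x] [m y]; unfold umul; cbn [fst snd]. rewrite Cmod_mul.
    pose proof (norm_triangle A (add A (scal A l y) (scal A m x)) (mul A x y)).
    pose proof (norm_triangle A (scal A l y) (scal A m x)).
    rewrite !norm_scal in *. pose proof (norm_mul A x y). lra.
  - intros u Hu.
    destruct (Cx_complete (fun n => fst (u n))) as [l Hl].
    { intros eps Heps. destruct (Hu eps Heps) as [n0 Hn0]. exists n0. intros m n Hm Hn.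
      specialize (Hn0 m n Hm Hn). cbn [fst snd] in Hn0. fold (Csub (fst (u m)) (fst (u n))) in Hn0.
      pose proof (norm_nonneg A (add A (snd (u m)) (opp A (snd (u n))))). lra. }
    destruct (complete A (fun n => snd (u n))) as [x Hx].
    { intros eps Heps. destruct (Hu eps Heps) as [n0 Hn0]. exists n0. intros m n Hm Hn.
      specialize (Hn0 m n Hm Hn). cbn [fst snd] in Hn0.
      pose proof (Cmod_nonneg (Cadd (fst (u m)) (Copp (fst (u n))))). lra. }
    exists (l, x). intros eps Heps.
    destruct (Hl (eps / 2) ltac:(lra)) as [n1 Hn1].
    destruct (Hx (eps / 2) ltac:(lra)) as [n2 Hn2].
    exists (n1 + n2)%nat. intros n Hn. cbn [fst snd].
    specialize (Hn1 n ltac:(lia)). specialize (Hn2 n ltac:(lia)). unfold Csub in Hn1. lra.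
Defined.

Lemma unitisation_unit : is_unit unitisation (Cone, zero A).
Proof.
  intros [l x]. split; cbn; unfold umul; cbn [fst snd]; f_equal; try (cx; ring); alg.
Qed.

End Unitisation.

(** * Assembly of the unital and the non-unital case *)

Theorem theorem17p12 (A : BanachStarAlgebra) (alpha : R) (Halpha : 2 <= alpha) :
  let beta := alpha + 1 in
  let i_ := hermitian A in
  let ii_ := forall a : A,
      let lam := max_nonneg_sp A (mul A (star A a) a) in
      forall z, sp A (mul A (star A a) a) z -> Im z = 0 /\ - lam <= Re z <= lam in
  let iii_ := forall a : A, r_sigma A a <= 1 ->
      let c := scal A (RtoC (/ alpha))
                 (sub A (scal A (RtoC beta) a) (mul A (mul A a (star A a)) a)) in
      r_sigma A c <= 1 in
  let iv_ := forall (a : A) (t : R), t < 0 -> ~ sp A (mul A (star A a) a) (RtoC t) in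
  let v_ := forall a : A, inv_At A Cone (mul A (star A a) a) in
  (i_ <-> ii_) /\ (i_ <-> iii_) /\ (i_ <-> iv_) /\ (i_ <-> v_).
Proof.
  destruct (classic (has_unit A)) as [[u Hu]|Hn].
  - apply (hermitian_characterisations A A u (fun x => x)); try reflexivity; try assumption.
    + intros l x. split.
      * intros [[_ [v [Hv H]]]|[H _]]; [|destruct H; now exists u].
        (* Two units coincide. *)
        replace v with u in H; [exact H|].
        rewrite <- (proj1 (Hu v)). symmetry; rewrite (proj2 (Hv u)); reflexivity.
      * intros H. left. split; [now exists u|now exists u].
    + intros b Hb. exists 0, b. split; [exact Hb|alg].
  - apply (hermitian_characterisations A (unitisation A) (Cone, zero A) (fun x => (Czero, x)));
      try assumption.
    + apply unitisation_unit.
    + intros x y; cbn; f_equal; cx; ring.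
    + intros c x; cbn; f_equal; cx; ring.
    + intros x y; cbn; unfold umul; cbn [fst snd]; f_equal; [cx; ring|alg].
    + intros x; cbn; f_equal; cx; ring.
    + intros x; cbn. rewrite Cmod_Czero; ring.
    + intros l x.
      replace (add (unitisation A) (scal (unitisation A) l (Cone, zero A)) (Czero, x))
        with ((l, x) : unitisation A) by (cbn; f_equal; [cx; ring|alg]).
      split.
      * intros [[H _]|[_ H]]; [contradiction|exact H].
      * intros H. right. now split.
    (* Self-adjointness makes the scalar component real, so it equals [Re l]. *)
    + intros [l x] H. cbn in H. injection H as H1 H2. apply (f_equal Im) in H1. simpl in H1. exists (Re l), x. split; [assumption|].
      cbn. f_equal; [cx; lra|alg].
Qed.
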